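(* Let $q\in\tfrac{1}{2}\mathbb{Z}\setminus\mathbb{Z}_{\leq 0}$. Then elements of the sequence $\left\{\Gamma^{(n)}(q)\right\}_{n\geq 1}$ are transcendental infinitely often; that is, there exist infinitely many integers $n\geq 1$ such that $\Gamma^{(n)}(q)$ is transcendental.
   Context: $\Gamma$ denotes the Euler Gamma function (meromorphically continued, so that it is analytic at every real point outside $\mathbb{Z}_{\leq 0}=\{0,-1,-2,\ldots\}$), and $\Gamma^{(n)}(q)$ denotes its $n$-th derivative evaluated at $q$. The set $\tfrac{1}{2}\mathbb{Z}=\{k/2: k\in\mathbb{Z}\}$, so $\tfrac{1}{2}\mathbb{Z}\setminus\mathbb{Z}_{\leq 0}$ consists of all positive integers and all (positive or negative) half-odd-integers. A number is transcendental if it is not algebraic over $\mathbb{Q}$. *)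

(* Defs.v *)
From HB Require Import structures.
From mathcomp Require Import all_boot all_order all_algebra.
From mathcomp Require Import all_classical all_reals all_analysis.
Set Implicit Arguments.
Unset Strict Implicit.
Unset Printing Implicit Defensive.
Import Order.TTheory GRing.Theory Num.Theory.
Import numFieldNormedType.Exports.
Local Open Scope classical_set_scope.
Local Open Scope ring_scope.

(* Meaningful for 0 < x, where the integral converges. *)
Definition euler_integral (R : realType) (x : R) : R :=
  \int[@lebesgue_measure R]_(t in `]0, +oo[) (t `^ (x - 1) * expR (- t)).

(* Number of unit steps to the right that bring x into ]0, +oo[: the least
   m such that 0 < x + m%:R. *)
Definition gamma_shift (R : realType) (x : R) : nat := Num.truncn (1 - x).

(* The Gamma function on the real line, continued to the negative non-integers
   by Gamma x = Gamma (x + m) / (x (x + 1) ... (x + m - 1)).  At the poles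
   0, -1, -2, ... the denominator vanishes and the value is the conventional 0.
   The derivatives of the meromorphic Gamma function at a real non-pole are the
   real derivatives of this restriction. *)
Definition Gamma (R : realType) (x : R) : R :=
  let m := gamma_shift x in
  euler_integral (x + m%:R) / \prod_(i < m) (x + i%:R).

Lemma Gamma_gt0E (R : realType) (x : R) : 0 < x -> Gamma x = euler_integral x.
Proof.
move=> x0; rewrite /Gamma /gamma_shift.
have -> : Num.truncn (1 - x) = 0%N.
  by apply/truncn0Pn; rewrite -ltNge gtrBl.
by rewrite big_ord0 divr1 addr0.
Qed.

Lemma Gamma_le0E (R : realType) (x : R) : x <= 0 -> Gamma x = Gamma (x + 1) / x.
Proof.
move=> x0; rewrite /Gamma /gamma_shift.
have -> : Num.truncn (1 - x) = (Num.truncn (1 - (x + 1))).+1.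
  apply/truncn_def.
  have h : 0 <= 1 - (x + 1) by rewrite opprD addrCA subrr addr0 oppr_ge0.
  have /andP[h1 h2] := truncn_itv h.
  have -> : 1 - x = 1 - (x + 1) + 1 by rewrite opprD addrA subrK.
  by apply/andP; split; rewrite -natr1 ?lerD2r ?ltrD2r.
set m := Num.truncn _.
rewrite big_ord_recl addr0 invfM (mulrC x^-1) mulrA -natr1.
rewrite [m%:R + 1]addrC addrA; congr (_ / _ / _).
by apply: eq_bigr => i _; rewrite lift0 -natr1 [_%:R + 1]addrC addrA.
Qed.

(* Main.v *)
Require Import Defs.
From HB Require Import structures.
From mathcomp Require Import all_boot all_order all_algebra.
From mathcomp Require Import all_classical all_reals all_analysis.
From mathcomp Require mpoly.
From mathcomp Require Import measurable_realfun complex perm ring lra zify.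
Import -(notations) mpoly.
Set Implicit Arguments.
Unset Strict Implicit.
Unset Printing Implicit Defensive.
Import Order.TTheory GRing.Theory Num.Theory.
Import numFieldNormedType.Exports.
Local Open Scope classical_set_scope.
Local Open Scope ring_scope.

(** Suppose that from some order N on all the derivatives of Gamma at q are
    algebraic, and let K be the field of real algebraic numbers.  Then the
    derivatives of all orders lie in a K-vector space V with finitely many
    generators, namely 1 and the derivatives of order less than N.  The equation
    Gamma(x + 1) = x Gamma(x), differentiated n times at a point q of K, expresses
    the derivatives at q and those at q + 1 through each other over K
    ([gamma_derivD1], [aspan_gammaD1]).  Hence V also contains all the
    derivatives at the representative b of q modulo 1 that is 1/2 or 1
    ([half_integer_base]).

    At these two points the reflection formula reads
    Gamma(1/2 + x) Gamma(1/2 - x) = pi / cos(pi x) and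
    Gamma(1 + x) Gamma(1 - x) = pi x / sin(pi x).  The derivatives of the left
    sides at x = 0 are quadratic in the derivatives of Gamma at b, so they lie in
    the K-space spanned by the products of two generators of V.  Those of the
    right sides are rational multiples of pi^(n+1) or pi^n
    ([refl_coeff_rational]), and infinitely many of them are nonzero
    ([rational_reciprocal_neq0]).  So infinitely many powers of pi lie in a
    finite-dimensional K-space, and a dependence between some of them makes pi
    algebraic ([aspan_powers_algebraic], [base_not_aspan]), against Lindemann's
    theorem ([pi_transcendental]).

    Three ingredients are established from first principles.  Lindemann's theorem
    is proved by Hermite's method: the vanishing product of the 1 + e^c over the
    conjugates c of i pi is expanded into exponentials of subset sums, whose
    symmetric functions are rational.  The smoothness of the Euler integral
    follows by differentiation under the integral sign, with
    t^(x-1) |ln t|^n e^(-t) dominated by functions t^(p-1) e^(-t) ([is_derive_gjet]); it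
    extends to the left of 0 by unit steps ([gamma_jet_nonpole]).  The reflection
    formula ([gjet_reflection]) is a comparison of two limits: the integrals of
    cos(2 x t) cos(t)^(2m) over a quarter period give Euler's product for the
    sine, and log-convexity, in the form Gamma(a + x) <= a^x Gamma(a), gives the
    same product for Gamma(1 + x) Gamma(1 - x). *)

(** * Integrality of symmetric functions of subset sums of roots *)

Lemma mmap_comp_mpoly (R : comNzRingType) (n k : nat) (h : 'I_k -> R)
    (T : n.-tuple (mpoly k int)) (t : mpoly n int) :
  mmap intr h (comp_mpoly T t) =
  mmap intr (fun i => mmap intr h (tnth T i)) t.
Proof.
rewrite [in RHS]/mmap /comp_mpoly [in LHS]/(mmap (@mpolyC _ _)) rmorph_sum /=.
apply: eq_bigr => m _; rewrite rmorphM /= mmapC; congr (_ * _).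
by rewrite /mmap1 rmorph_prod; apply: eq_bigr => i _; rewrite rmorphXn.
Qed.

Lemma mmap_intr_int (R : comNzRingType) (n : nat) (a : 'I_n -> int)
    (t : mpoly n int) :
  mmap intr (fun i => (a i)%:~R : R) t = (meval a t)%:~R.
Proof.
rewrite /meval /mmap rmorph_sum /=; apply: eq_bigr => m _.
rewrite rmorphM /=; congr (_ * _).
by rewrite /mmap1 rmorph_prod; apply: eq_bigr => i _; rewrite rmorphXn.
Qed.

(** By the fundamental theorem a symmetric polynomial with integer coefficients
    is an integer polynomial in the elementary ones, and the values of these at
    the roots of P are the coefficients of P up to sign. *)
Lemma symmetric_at_integral_roots (R : idomainType) (n : nat) (cs : n.-tuple R)
    (P : {poly int}) (p : mpoly n int) :
  \prod_(c <- cs) ('X - c%:P) = map_poly intr P ->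
  p \is symmetric -> exists z : int, mmap intr (tnth cs) p = z%:~R.
Proof.
move=> csP /sym_fundamental[t [<- _]]; rewrite mmap_comp_mpoly.
pose a (i : 'I_n) : int := (-1) ^+ i.+1 * P`_(n - i.+1).
exists (meval a t); rewrite -mmap_intr_int; congr (mmap _ _ t).
apply/funext => i; rewrite tnth_mktuple /a.
rewrite rmorphM rmorphXn rmorphN1 -coef_map -csP.
rewrite (mroots_coeff cs (Ordinal (ltn_ord i : i.+1 < n.+1)%N)) mulrA -exprD.
rewrite addnn -mul2n exprM sqrrN !expr1n mul1r.
rewrite /mesym [LHS]raddf_sum [RHS]raddf_sum /=; apply: eq_bigr => A _.
rewrite !rmorph_prod /=; apply: eq_bigr => j _.
by rewrite mmapX mmap1U mevalXU.
Qed.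

Lemma msymXU (n : nat) (s : 'S_n) (i : 'I_n) :
  msym s (mpolyX int (mnm1 i)) = mpolyX int (mnm1 (s i)).
Proof. by rewrite /msym mmapX mmap1U. Qed.

(** The sums over subsets are kept as polynomials in independent variables, so
    that a permutation of the variables acts on them by permuting the subsets
    and every symmetric expression in the sums is symmetric in the variables. *)
Definition generic_subset_sum (n : nat) (A : {set 'I_n}) : mpoly n int :=
  \sum_(j in A) mpolyX int (mnm1 j).

Lemma msym_subset_sum (n : nat) (s : 'S_n) (A : {set 'I_n}) :
  msym s (generic_subset_sum A) = generic_subset_sum (s @: A).
Proof.
rewrite /generic_subset_sum rmorph_sum /= big_imset /=; last first.
  by move=> i j _ _; apply: perm_inj.
by apply: eq_bigr => i _; rewrite msymXU.
Qed.

Lemma reindex_imset_perm (T : Type) (idx : T) (op : Monoid.com_law idx)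
    (n : nat) (s : 'S_n) (F : {set 'I_n} -> T) :
  \big[op/idx]_(A : {set 'I_n}) F (s @: A) = \big[op/idx]_A F A.
Proof.
rewrite [RHS](reindex_inj (h := fun A : {set 'I_n} => s @: A)) //.
exact/imset_inj/perm_inj.
Qed.

Section SubsetSums.
Variables (R : idomainType) (n : nat) (cs : n.-tuple R) (P : {poly int}).
Hypothesis csP : \prod_(c <- cs) ('X - c%:P) = map_poly intr P.

Definition subset_sum (A : {set 'I_n}) : R := \sum_(j in A) tnth cs j.

Let evalE (A : {set 'I_n}) :
  mmap intr (tnth cs) (generic_subset_sum A) = subset_sum A.
Proof. by rewrite rmorph_sum; apply: eq_bigr => i _; rewrite /= mmapX mmap1U. Qed.

Lemma sum_subset_sums_int (G : {poly int}) :
  exists z : int, \sum_A (map_poly intr G).[subset_sum A] = z%:~R.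
Proof.
pose p : mpoly n int :=
  \sum_(A : {set 'I_n}) (map_poly intr G).[generic_subset_sum A].
have /(symmetric_at_integral_roots csP)[z zE] : p \is symmetric.
  apply/issymP => s; rewrite rmorph_sum /= -[RHS](reindex_imset_perm _ s).
  apply: eq_bigr => A _; rewrite -horner_map /= msym_subset_sum -map_poly_comp.
  by congr (_.[_]); apply: eq_map_poly => k /=; rewrite rmorph_int.
exists z; rewrite -zE rmorph_sum; apply: eq_bigr => A _ /=.
rewrite -horner_map /= evalE -map_poly_comp.
by congr (_.[_]); apply: eq_map_poly => k /=; rewrite rmorph_int.
Qed.

Lemma prod_subset_sums_int :
  exists Q : {poly int}, \prod_A ('X - (subset_sum A)%:P) = map_poly intr Q.
Proof.
pose p : {poly mpoly n int} :=
  \prod_(A : {set 'I_n}) ('X - (generic_subset_sum A)%:P).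
have pE : \prod_A ('X - (subset_sum A)%:P) = map_poly (mmap intr (tnth cs)) p.
  rewrite rmorph_prod; apply: eq_bigr => A _.
  by rewrite /= rmorphB /= map_polyX map_polyC /= evalE.
have coefZ k : exists z : int, mmap intr (tnth cs) p`_k = z%:~R.
  apply: symmetric_at_integral_roots csP _; apply/issymP => s.
  rewrite -coef_map; suff -> : map_poly (msym s) p = p by [].
  rewrite rmorph_prod.
  rewrite -[RHS](reindex_imset_perm _ s); apply: eq_bigr => A _.
  by rewrite /= rmorphB /= map_polyX map_polyC /= msym_subset_sum.
have [z zE] := choice coefZ.
exists (\poly_(k < size p) z k); rewrite pE; apply/polyP => k.
rewrite !coef_map /= zE coef_poly; case: ltnP => // sz.
by rewrite -zE nth_default // rmorph0 rmorph0.
Qed.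

End SubsetSums.

(** * Taylor's bound for the complex exponential *)

Section ComplexExponential.
Local Open Scope complex_scope.
Local Notation Re := complex.Re.
Local Notation Im := complex.Im.
Variable R : realType.
Implicit Types (t : R) (z : R[i]).

Definition cexp z : R[i] :=
  (expR (Re z) * cos (Im z)) +i* (expR (Re z) * sin (Im z)).

Lemma cexpD z w : cexp (z + w) = cexp z * cexp w.
Proof.
case: z w => [a b] [c d]; rewrite /cexp /= expRD cosD sinD.
by apply/eqP; rewrite eq_complex /=; apply/andP; split; apply/eqP; ring.
Qed.

Lemma cexp0 : cexp 0 = 1.
Proof. by rewrite /cexp /= expR0 cos0 sin0 mulr1 mulr0. Qed.

Lemma cexp_sum (I : finType) (P : pred I) (F : I -> R[i]) :
  cexp (\sum_(i | P i) F i) = \prod_(i | P i) cexp (F i).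
Proof. by apply: (big_morph cexp cexpD cexp0). Qed.

Lemma cexp_pi : cexp (0 +i* pi) = -1.
Proof.
rewrite /cexp /= expR0 cospi sinpi !mul1r.
by apply/eqP; rewrite eq_complex /= oppr0 !eqxx.
Qed.

Lemma normC_real (x : R) : `|x%:C| = `|x|%:C.
Proof. by rewrite normc_def /= expr0n addr0 sqrtr_sqr. Qed.

Lemma normC_le_ReIm z : `|z| <= (`|Re z| + `|Im z|)%:C.
Proof.
rewrite {1}(complexE z) (le_trans (ler_normD _ _)) // normrM !normC_real.
have -> : `|'i%C| = 1 :> R[i].
  by rewrite normc_def /= expr0n expr1n add0r sqrtr1.
by rewrite mul1r rmorphD.
Qed.

(** Applied to a Taylor remainder and a multiple of a monomial: it carries a
    bound on one remainder to a bound on the next, which is its primitive. *)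
Lemma norm_le_of_derive (f g df dg : R -> R) t :
  (forall s : R, is_derive s 1 f (df s)) -> (forall s : R, is_derive s 1 g (dg s)) ->
  (forall s, 0 <= s <= 1 -> `|df s| <= dg s) ->
  f 0 = 0 -> g 0 = 0 -> 0 <= t <= 1 -> `|f t| <= g t.
Proof.
move=> fd gd le f0 g0 /andP[t0 t1].
suff key (h dh : R -> R) : (forall s : R, is_derive s 1 h (dh s)) ->
    (forall s, 0 <= s <= 1 -> 0 <= dh s) -> h 0 = 0 -> 0 <= h t.
  rewrite ler_norml -subr_ge0 opprK -[X in _ && X]subr_ge0; apply/andP; split.
  - have := key _ _ (fun s => is_deriveD (fd s) (gd s)).
    rewrite !fctE addrC; apply; last by rewrite f0 g0 addr0.
    by move=> s /le; rewrite ler_norml => /andP[]; lra.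
  - have := key _ _ (fun s => is_deriveB (gd s) (fd s)).
    rewrite !fctE; apply; last by rewrite f0 g0 subr0.
    by move=> s /le; rewrite ler_norml => /andP[]; lra.
move=> hd dh0 h0; rewrite -h0.
apply: (@ger0_derive1_ndecr _ h 0 1) => //.
- move=> x; rewrite in_itv /= => /andP[x0 x1].
  by rewrite derive1E (@derive_val _ _ _ _ _ _ _ (hd x)) dh0 // !ltW.
- apply: derivable_within_continuous => x _; by have [] := hd x.
Qed.

Section Remainder.
Variable z : R[i].
Let a := Re z.
Let b := Im z.
Let c n := Re (z ^+ n).
Let d n := Im (z ^+ n).
Let L := `|a| + `|b|.

Let cS n : c n.+1 = a * c n - b * d n.
Proof. by rewrite /c exprS /d /a /b; case: z (z ^+ n) => [? ?] []. Qed.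
Let dS n : d n.+1 = a * d n + b * c n.
Proof. by rewrite /d exprS /c /a /b; case: z (z ^+ n) => [? ?] []. Qed.

Let tay (u : nat -> R) n : {poly R} := \poly_(j < n) (u j / j`!%:R).
Let re n t := expR (t * a) * cos (t * b) - (tay c n).[t].
Let im n t := expR (t * a) * sin (t * b) - (tay d n).[t].

Let deriv_tay u n : (tay u n.+1)^`() = tay (u \o succn) n.
Proof.
apply/polyP => j; rewrite coef_deriv !coef_poly ltnS.
case: ltnP => // _; last by rewrite mul0rn.
have n0 : j`!%:R != 0 :> R by rewrite pnatr_eq0 -lt0n fact_gt0.
have m0 : j.+1%:R != 0 :> R by rewrite pnatr_eq0.
rewrite factS natrM -[LHS]mulr_natr invfM.
by move: m0 n0; move: j.+1%:R j`!%:R => x y x0 y0 /=; field; rewrite x0 y0.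
Qed.

Let is_derive_dilate (f : R -> R) k df t :
  is_derive (t * k) 1 f df -> is_derive t 1 (fun s => f (s * k)) (df * k).
Proof.
move=> fd; apply: (@is_derive1_comp _ f (fun s => s * k)).
have : is_derive t 1 (id * cst k : R -> R) k; last by [].
by apply: is_derive_eq; rewrite scaler0 add0r [LHS]mulr1.
Qed.

Let is_derive_re n t : is_derive t 1 (re n.+1) (a * re n t - b * im n t).
Proof.
have D1 := @is_derive_dilate expR a _ t (is_derive_expR _).
have D2 := @is_derive_dilate cos b _ t (is_derive_cos _).
apply: (is_derive_eq (is_deriveB (is_deriveM D1 D2) (is_derive_poly _ _))).
have -> : (tay c n.+1)^`() = a *: tay c n - b *: tay d n.
  rewrite deriv_tay; apply/polyP => j; rewrite coefB !coefZ !coef_poly /= cS.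
  by case: ifP => _; [rewrite mulrBl !mulrA | rewrite !mulr0 subr0].
rewrite hornerD hornerN !hornerZ /re /im -!/(_ * _).
rewrite -![_ *: _]/(_ * _); ring.
Qed.

Let is_derive_im n t : is_derive t 1 (im n.+1) (a * im n t + b * re n t).
Proof.
have D1 := @is_derive_dilate expR a _ t (is_derive_expR _).
have D2 := @is_derive_dilate sin b _ t (is_derive_sin _).
apply: (is_derive_eq (is_deriveB (is_deriveM D1 D2) (is_derive_poly _ _))).
have -> : (tay d n.+1)^`() = a *: tay d n + b *: tay c n.
  rewrite deriv_tay; apply/polyP => j; rewrite coefD !coefZ !coef_poly /= dS.
  by case: ifP => _; [rewrite mulrDl !mulrA | rewrite !mulr0 addr0].
rewrite hornerD !hornerZ /re /im -![_ *: _]/(_ * _); ring.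
Qed.

Let re0 n : re n.+1 0 = 0.
Proof.
by rewrite /re !mul0r expR0 cos0 mulr1 horner_coef0 coef_poly /= /c expr0 divr1 subrr.
Qed.

Let im0 n : im n.+1 0 = 0.
Proof.
by rewrite /im !mul0r sin0 mulr0 horner_coef0 coef_poly /= /d expr0 divr1 subrr.
Qed.

Let maj n t := expR `|a| * (L * t) ^+ n / n`!%:R.

Let is_derive_maj n t : is_derive t 1 (maj n.+1) (L * maj n t).
Proof.
pose p : {poly R} := (expR `|a| * L ^+ n.+1 / n.+1`!%:R) *: 'X^(n.+1).
have -> : maj n.+1 = horner p.
  apply/funext => s; rewrite /p /maj hornerZ hornerXn exprMn; ring.
apply: (is_derive_eq (is_derive_poly _ _)).
rewrite /p derivZ derivXn hornerZ hornerMn hornerXn /maj factS natrM exprMn exprS.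
rewrite -[X in _ * X]mulr_natr /=.
have n0 : n`!%:R != 0 :> R by rewrite pnatr_eq0 -lt0n fact_gt0.
have m0 : n.+1%:R != 0 :> R by rewrite pnatr_eq0.
rewrite invfM; move: n.+1%:R n`!%:R m0 n0 => x y x0 y0.
by field; rewrite x0 y0.
Qed.

Let re_im_le n t : 0 <= t <= 1 -> `|re n t| <= maj n t /\ `|im n t| <= maj n t.
Proof.
elim: n t => [|n IH] t t01.
  rewrite /re /im /maj !expr0 fact0 divr1 mulr1.
  rewrite /tay !poly_def !big_ord0 !horner0 !subr0 !normrM !(ger0_norm (expR_ge0 _)).
  have ta : t * a <= `|a|.
    case/andP: t01 => t0 t1; have := ler_norm a; have := normr_ge0 a; nra.
  by split; rewrite -[leRHS]mulr1 ler_pM ?expR_ge0 ?ler_expR ?cos_max ?sin_max ?normr_ge0.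
have maj0 : maj n.+1 0 = 0 by rewrite /maj mulr0 expr0n mulr0 mul0r.
split.
- apply: (norm_le_of_derive (is_derive_re n) (is_derive_maj n) _ (re0 n) maj0 t01).
  move=> s /IH[rs js]; rewrite (le_trans (ler_normB _ _)) // !normrM mulrDl.
  by rewrite lerD ?ler_wpM2l.
- apply: (norm_le_of_derive (is_derive_im n) (is_derive_maj n) _ (im0 n) maj0 t01).
  move=> s /IH[rs js]; rewrite (le_trans (ler_normD _ _)) // !normrM mulrDl.
  by rewrite lerD ?ler_wpM2l.
Qed.

(** Along the segment t |-> t z the real and imaginary parts of the successive
    Taylor remainders are primitives of linear combinations, with coefficients
    a and b, of the preceding ones; hence an induction gives the bound
    e^|a| (|a| + |b|)^n / n! for z = a + b i. *)
Lemma cexp_taylor : exists C B : R, [/\ 0 <= C, 0 <= B & forall n,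
  `|cexp z - \sum_(j < n.+1) z ^+ j / j`!%:R| <= (C * B ^+ n / n`!%:R)%:C].
Proof.
have L0 : 0 <= L by rewrite addr_ge0.
have e0 := expR_ge0 `|a|.
exists (2 * expR `|a| * L), L; split=> //; first by rewrite !mulr_ge0.
move=> n; rewrite (le_trans (normC_le_ReIm _)) // lecR.
have tayE (u : nat -> R) : (tay u n.+1).[1] = \sum_(j < n.+1) u j / j`!%:R.
  by rewrite horner_poly; apply: eq_bigr => j _; rewrite expr1n mulr1.
have natC (j : nat) : j%:R = (j%:R)%:C :> R[i] by rewrite rmorph_nat.
have ReM (x : R) (w : R[i]) : Re (w / x%:C) = Re w / x.
  by rewrite -fmorphV; case: w => u v /=; rewrite mulr0 subr0.
have ImM (x : R) (w : R[i]) : Im (w / x%:C) = Im w / x.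
  by rewrite -fmorphV; case: w => u v /=; rewrite mulr0 add0r.
have -> : Re (cexp z - \sum_(j < n.+1) z ^+ j / j`!%:R) = re n.+1 1.
  rewrite /re !mul1r tayE (raddfB (@Re R : Rcomplex R -> R)) raddf_sum /=.
  by congr (_ - _); apply: eq_bigr => j _; rewrite natC ReM.
have -> : Im (cexp z - \sum_(j < n.+1) z ^+ j / j`!%:R) = im n.+1 1.
  rewrite /im !mul1r tayE (raddfB (@Im R : Rcomplex R -> R)) raddf_sum /=.
  by congr (_ - _); apply: eq_bigr => j _; rewrite natC ImM.
have /(re_im_le n.+1)[r i] : 0 <= (1 : R) <= 1 by rewrite ler01 lexx.
apply: le_trans (lerD r i) _; rewrite /maj mulr1 factS natrM exprS.
have -> : 2 * expR `|a| * L * L ^+ n / n`!%:R = 2 * (expR `|a| * (L * L ^+ n) / n`!%:R).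
  ring.
rewrite -mulr2n -[leLHS]mulr_natl ler_wpM2l // ler_wpM2l ?mulr_ge0 ?exprn_ge0 //.
rewrite lef_pV2 ?posrE ?mulr_gt0 ?ltr0n ?fact_gt0 //.
by rewrite -[leLHS]mul1r ler_wpM2r // ler1n.
Qed.

End Remainder.
End ComplexExponential.

(** * Hermite's method *)

Lemma factor_derivn (K : comNzRingType) (T H : {poly K}) (k j : nat) :
  (j <= k)%N -> exists H', (T ^+ k * H)^`(j) = T ^+ (k - j) * H'.
Proof.
elim: j k H => [|j IH] k H; first by exists H; rewrite subn0 derivn0.
case: k => // k jk; rewrite derivSn derivM deriv_exp.
have -> : T^`() * T ^+ k *+ k.+1 * H + T ^+ k.+1 * H^`() =
    T ^+ k * (T^`() * H *+ k.+1 + T * H^`()).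
  by rewrite exprS mulrDr mulrnAl mulrnAr; congr (_ *+ _ + _); ring.
by rewrite subSS; exact: IH.
Qed.

(** Hermite's operator g |-> g + a g' + a^2 g'' + ..., which replaces the
    integral of g e^(-x/a) in his method: e^(x/a) times its value at 0 differs
    from its value at x by Taylor remainders of the exponential only. *)
Definition hermite (K : nzRingType) (a : K) (g : {poly K}) (x : K) : K :=
  \sum_(j < size g) a ^+ j * g^`(j).[x].

(** The inner sum is the Taylor polynomial of e^b; at b = 0 it equals 1.  So
    e^b hermite a g 0 - hermite a g (a b) is a combination of the remainders of
    order k with coefficients g_k a^k k!, and the factor k! is cancelled by the
    size of these remainders. *)
Lemma hermite_scaled (K : numFieldType) (a b : K) (g : {poly K}) :
  hermite a g (a * b) =
  \sum_(k < size g) g`_k * a ^+ k * k`!%:R *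
                    (\sum_(l < k.+1) b ^+ l / l`!%:R).
Proof.
have fact0 l : l`!%:R != 0 :> K by rewrite pnatr_eq0 -lt0n fact_gt0.
transitivity (\sum_(j < size g) \sum_(k < size g)
    g`_k * a ^+ j * (a * b) ^+ (k - j) * (k ^_ j)%:R).
  apply: eq_bigr => -[j /= _] _; have -> : g^`(j) = \sum_(k < size g) (g`_k *: 'X^k)^`(j).
    by rewrite -[in LHS](coefK g) poly_def linear_sum.
  rewrite horner_sum mulr_sumr; apply: eq_bigr => k _.
  rewrite linearZ /= derivnXn hornerZ hornerMn hornerXn.
  by rewrite -[in LHS](mulr_natr (_ ^+ _)); ring.
rewrite exchange_big; apply: eq_bigr => k _ /=.
pose G j := g`_k * a ^+ j * (a * b) ^+ (k - j) * (k ^_ j)%:R.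
transitivity (\sum_(j < k.+1) G j).
  rewrite (big_ord_widen (size g) G (ltn_ord k)) [RHS]big_mkcond; apply: eq_bigr => j _.
  by case: ltnP => // kj; rewrite ffact_small ?mulr0.
rewrite mulr_sumr (reindex_inj rev_ord_inj); apply: eq_bigr => l _ /=.
have lk : (l <= k)%N by rewrite -ltnS.
rewrite /G subSS subKn // -(ffact_fact (leq_subr l k)) subKn // natrM exprMn.
have -> : a ^+ k = a ^+ (k - l) * a ^+ l by rewrite -exprD subnK.
by have := fact0 l; move: (l`!%:R) => f f0; field.
Qed.

Lemma dvdn_fact_le m n : (m <= n)%N -> (m`! %| n`!)%N.
Proof. by move=> mn; rewrite (fact_split mn) dvdn_mulr. Qed.

(** The value at r of the polynomial with the absolute values of the
    coefficients of g.  It is submultiplicative in g, so it grows only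
    geometrically on T^p X^(p-1). *)
Definition absval (g : {poly int}) (K : numDomainType) (r : K) : K :=
  \sum_(k < size g) `|g`_k|%:~R * r ^+ k.

Lemma absvalM (g h : {poly int}) (K : numDomainType) (r : K) : 0 <= r ->
  absval (g * h) r <= absval g r * absval h r.
Proof.
move=> r0; pose A (p : {poly int}) := \poly_(k < size p) `|p`_k|.
have AE p : absval p r = (map_poly intr (A p)).[r].
  rewrite (@horner_coef_wide _ (size p)); last first.
    by rewrite (leq_trans (size_poly _ _)) ?size_poly.
  by apply: eq_bigr => k _; rewrite coef_map coef_poly ltn_ord.
have Acoef p k : (A p)`_k = `|p`_k|.
  by rewrite coef_poly; case: ltnP => // /(nth_default 0) ->; rewrite normr0.
rewrite !AE -hornerM -rmorphM /=.
set n := maxn (size (A (g * h))) (size (A g * A h)).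
have wide (q : {poly int}) : (size q <= n)%N ->
    (map_poly intr q).[r] = \sum_(k < n) (map_poly intr q)`_k * r ^+ k.
  by move=> qn; rewrite (@horner_coef_wide _ n) // (leq_trans (size_poly _ _)).
rewrite !wide ?leq_maxl ?leq_maxr //.
apply: ler_sum => k _; rewrite ler_wpM2r ?exprn_ge0 // !coef_map ler_int Acoef !coefM.
by rewrite (le_trans (ler_norm_sum _ _ _)) // ler_sum // => i _; rewrite normrM !Acoef.
Qed.

Lemma absval_ge0 (g : {poly int}) (K : numDomainType) (r : K) :
  0 <= r -> 0 <= absval g r.
Proof. by move=> r0; apply: sumr_ge0 => k _; rewrite mulr_ge0 ?exprn_ge0 ?ler0z. Qed.

Lemma absvalX (g : {poly int}) (K : numDomainType) (r : K) n : 0 <= r ->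
  absval (g ^+ n) r <= absval g r ^+ n.
Proof.
move=> r0; elim: n => [|n IH].
  by rewrite !expr0 /absval size_poly1 big_ord1 coef1 normr1 mul1r expr0.
by rewrite !exprS (le_trans (absvalM _ _ r0)) // ler_wpM2l ?absval_ge0.
Qed.

Lemma hermite_int (K : numDomainType) (a z : int) (g : {poly int}) :
  hermite (a%:~R : K) (map_poly intr g) z%:~R = (hermite a g z)%:~R.
Proof.
rewrite /hermite size_map_inj_poly ?rmorph0 //; last exact: intr_inj.
rewrite rmorph_sum; apply: eq_bigr => j _.
by rewrite rmorphM rmorphXn derivn_map horner_map.
Qed.

(** At a root of T the derivatives of T^p H of order below p vanish, and those of
    order j >= p are j! times a polynomial with integer coefficients.  The
    result is kept as p! times the value of one integer polynomial, so that
    values at several conjugate roots can be summed. *)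
Lemma hermite_at_root (K : numDomainType) (a : int) (T H : {poly int}) p (x : K) :
  (map_poly intr T).[x] = 0 ->
  hermite a%:~R (map_poly intr (T ^+ p * H)) x = p`!%:R *
   (map_poly intr (\sum_(j < size (T ^+ p * H) | (p <= j)%N)
     a ^+ j *: ((T ^+ p * H)^`N(j) *+ (j`! %/ p`!)))).[x].
Proof.
move=> Tx; set g := T ^+ p * H.
rewrite /hermite size_map_inj_poly ?rmorph0 //; last exact: intr_inj.
rewrite (bigID (fun j : 'I__ => (p <= j)%N)) /= [X in _ + X]big1 ?addr0; last first.
  move=> j; rewrite -ltnNge => jp; have [H' gE] := factor_derivn T H (ltnW jp).
  rewrite derivn_map gE rmorphM rmorphXn hornerM horner_exp Tx expr0n subn_eq0.
  by rewrite leqNgt jp !(mul0r, mulr0).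
rewrite rmorph_sum horner_sum mulr_sumr; apply: eq_bigr => j pj.
rewrite derivn_map; have -> : g^`(j) = g^`N(j) *+ (j`! %/ p`!) *+ p`!.
  by rewrite -mulrnA divnK ?dvdn_fact_le // nderivn_def.
rewrite -mul_polyC rmorphM /= map_polyC /= rmorphXn hornerM hornerC.
by rewrite [in LHS]rmorphMn hornerMn -mulr_natl mulrCA.
Qed.

(** At 0 the factor X^(p-1) kills the derivatives of order below p-1; the one of
    order p-1 gives a^(p-1) T(0)^p (p-1)!, and the higher ones are multiples of p!. *)
Lemma hermite_at_0 (a : int) (T : {poly int}) p : (0 < p)%N ->
  exists z : int, hermite a (T ^+ p * 'X^(p.-1)) 0 =
    (p.-1)`!%:R * (a ^+ p.-1 * T`_0 ^+ p + p%:R * z).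
Proof.
case: p => // p _; set g := T ^+ p.+1 * 'X^p.
pose F j : int := a ^+ j * (g`_j * j`!%:R).
have gE j : g`_j = if (j < p)%N then 0 else (T ^+ p.+1)`_(j - p).
  by rewrite coefMXn.
pose n := maxn (size g) p.+1.
have -> : hermite a g 0 = \sum_(0 <= j < n) F j.
  transitivity (\sum_(j < size g) F j).
    apply: eq_bigr => j _; rewrite horner_coef0 coef_derivn addn0 ffactnn.
    by rewrite /F mulr_natr.
  rewrite (big_ord_widen n F (leq_maxl _ _)) big_mkord big_mkcond.
  apply: eq_bigr => j _; case: ltnP => // gj.
  by rewrite /F nth_default // mul0r mulr0.
rewrite (@big_cat_nat _ _ _ p) //=; last by rewrite ltnW // leq_maxr.
rewrite big_nat big1 ?add0r; last by move=> j; rewrite /F gE => /= ->; rewrite mul0r mulr0.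
rewrite big_ltn ?leq_maxr // {1}/F gE ltnn subnn.
exists (\sum_(p.+1 <= j < n) a ^+ j * (g`_j * (j`! %/ p.+1`!)%:R)).
rewrite mulrDr; congr (_ + _).
  have -> k : (T ^+ k)`_0 = T`_0 ^+ k.
    by elim: k => [|k IH]; rewrite ?expr0 ?coef1 // !exprS coef0M IH.
  by rewrite /=; ring.
rewrite mulrA -natrM mulnC -factS mulr_sumr big_nat [RHS]big_nat.
apply: eq_bigr => j /andP[pj _].
rewrite /F -{1}(divnK (dvdn_fact_le pj)) natrM; ring.
Qed.

Lemma expr_lt_fact (R : realType) (c D : R) :
  \forall n \near \oo, c * D ^+ n < n`!%:R.
Proof.
have h : (c * exp_coeff D n) @[n --> \oo] --> c * 0.
  apply: cvgM; [exact: cvg_cst|exact: cvg_series_cvg_0 (is_cvg_series_exp_coeff D)].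
have := cvgr_lt _ h 1; rewrite mulr0 => /(_ _ ltr01).
apply: filterS => n; rewrite /exp_coeff mulrA ltr_pdivrMr ?mul1r //.
Qed.

(** Hermite's argument for m + \sum_i e^(beta_i), where the sigma_i = a beta_i are
    roots of an integer polynomial T with T(0) != 0 and all the symmetric
    expressions \sum_i G(sigma_i) are integers.  If the sum vanished, then
    m J(0) + \sum_i J(sigma_i), where J is Hermite's operator applied to
    T^p X^(p-1), would be the sum of the errors J(sigma_i) - e^(beta_i) J(0).
    The former is a nonzero integer multiple of (p-1)!, whereas the errors grow
    only geometrically in p. *)
Section LindemannSum.
Local Open Scope complex_scope.
Variables (R : realType) (I : finType) (P : pred I) (sigma : I -> R[i]).
Variables (a : int) (T : {poly int}) (m : nat).
Hypothesis a0 : a != 0.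
Hypothesis m0 : (0 < m)%N.
Hypothesis T0 : T`_0 != 0.
Hypothesis rootT : forall i, P i -> (map_poly intr T).[sigma i] = 0.
Hypothesis symT : forall G : {poly int}, exists z : int,
  \sum_(i | P i) (map_poly intr G).[sigma i] = z%:~R.

Let beta i := sigma i / a%:~R.

Let g p := T ^+ p * 'X^(p.-1).

Let int_part : forall p, prime p -> (m < p)%N -> (`|a| < p)%N -> (`|(T`_0)%R| < p)%N ->
  (p.-1)`!%:R <= `|m%:R * (hermite a (g p) 0)%:~R +
     \sum_(i | P i) hermite a%:~R (map_poly intr (g p)) (sigma i)|.
Proof.
move=> p p_prime mp ap Tp; have p0 := prime_gt0 p_prime.
have [z1] := hermite_at_0 a T p0; rewrite -/(g p) => ->.
pose G : {poly int} := \sum_(j < size (g p) | (p <= j)%N) a ^+ j *: ((g p)^`N(j) *+ (j`! %/ p`!)).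
have [z2 z2E] := symT G.
have -> : \sum_(i | P i) hermite a%:~R (map_poly intr (g p)) (sigma i) =
    (p`!%:R * z2)%:~R.
  rewrite intrM -z2E mulr_sumr; apply: eq_bigr => i /rootT Ti.
  by rewrite /g hermite_at_root // (rmorph_nat intr).
pose N := m%:R * (a ^+ p.-1 * T`_0 ^+ p) + p%:R * (m%:R * z1 + z2) : int.
rewrite (_ : m%:R = (m%:R : int)%:~R); last by rewrite (rmorph_nat intr).
rewrite -intrM -intrD.
have -> : m%:R * ((p.-1)`!%:R * (a ^+ p.-1 * T`_0 ^+ p + p%:R * z1)) + p`!%:R * z2
    = (p.-1)`!%:R * N :> int.
  by rewrite /N -(prednK p0) factS natrM /= prednK //; ring.
rewrite rmorphM normrM rmorph_nat normr_nat -[leLHS]mulr1 ler_wpM2l //.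
rewrite -intr_norm -[1]/(1%:~R) ler_int.
(* Modulo p only m a^(p-1) T(0)^p is left of N, and p divides none of its factors. *)
have : N != 0; last by rewrite -normr_gt0.
apply/negP => /eqP N0.
have : (p%:Z %| m%:R * (a ^+ p.-1 * T`_0 ^+ p))%Z.
  move/eqP: N0; rewrite /N addr_eq0 => /eqP ->.
  by rewrite -mulrN dvdz_mulr // natz.
rewrite dvdzE !abszM !abszX natz /= !Euclid_dvdM // !Euclid_dvdX //.
have small k : (0 < k)%N -> (k < p)%N -> (p %| k)%N = false.
  by move=> k0 kp; apply/negP => /(dvdn_leq k0); rewrite leqNgt kp.
by rewrite !small ?absz_gt0.
Qed.

Let error : exists C D : R, forall p, (0 < p)%N ->
  `|\sum_(i | P i) (cexp (beta i) * (hermite a (g p) 0)%:~R -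
      hermite a%:~R (map_poly intr (g p)) (sigma i))| <= (C * D ^+ p.-1)%:C.
Proof.
have [C /choice[B CBP]] := choice (fun i => cexp_taylor (beta i)).
pose r := `|a|%:~R * \sum_(i | P i) B i : R.
have Bi_ge0 i : 0 <= B i by have [] := CBP i.
have Ci_ge0 i : 0 <= C i by have [] := CBP i.
have sB0 : 0 <= \sum_(i | P i) B i by apply: sumr_ge0.
have r0 : 0 <= r by rewrite mulr_ge0.
have gr p : (0 < p)%N -> absval (g p) r <= absval T r * (absval T r * r) ^+ p.-1.
  move=> p0; rewrite (le_trans (absvalM _ _ r0)) //.
  rewrite exprMn mulrA -exprS prednK //.
  rewrite ler_pM ?absval_ge0 ?absvalX //.
  suff absX : absval 'X r = r by rewrite (le_trans (absvalX _ _ r0)) // absX.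
  rewrite /absval size_polyX big_ord_recl big_ord1 !coefX /=.
  by rewrite normr0 normr1 mul0r add0r mul1r expr1.
pose Cs := \sum_(i | P i) C i.
exists (Cs * absval T r), (absval T r * r) => p p0.
apply: (@le_trans _ _ (Cs * absval (g p) r)%:C); last first.
  by rewrite lecR -mulrA ler_wpM2l ?gr // sumr_ge0.
rewrite (le_trans (ler_norm_sum _ _ _)) // /Cs mulr_suml [leRHS]rmorph_sum /=.
apply: ler_sum => i Pi.
have [_ _ tay] := CBP i.
have sE : sigma i = a%:~R * beta i by rewrite /beta mulrC divfK // intr_eq0.
have J0E : (hermite a (g p) 0)%:~R = hermite a%:~R (map_poly intr (g p)) (a%:~R * 0) :> R[i].
  by rewrite mulr0 -hermite_int rmorph0.
rewrite sE J0E !hermite_scaled size_map_inj_poly ?rmorph0 //; last exact: intr_inj.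
rewrite mulr_sumr -sumrB /absval mulr_sumr [leRHS]rmorph_sum (le_trans (ler_norm_sum _ _ _)) //.
apply: ler_sum => k _.
have -> : \sum_(l < k.+1) 0 ^+ l / l`!%:R = 1 :> R[i].
  rewrite big_ord_recl big1 ?addr0 ?expr0 ?fact0 ?divr1 // => l _.
  by rewrite lift0 expr0n mul0r.
rewrite mulr1 mulrC -mulrBr normrM coef_map.
apply: (@le_trans _ _ (`|((g p)`_k * a ^+ k * k`!%:R)%:~R| * (C i * B i ^+ k / k`!%:R)%:C)).
  have -> : ((g p)`_k * a ^+ k * k`!%:R)%:~R =
      ((g p)`_k)%:~R * a%:~R ^+ k * k`!%:R :> R[i].
    by rewrite !intrM (rmorph_nat intr) -(rmorphXn intr).
  by rewrite ler_wpM2l.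
rewrite -intr_norm -(rmorph_int (real_complex R)) -rmorphM lecR.
rewrite !normrM normrX normr_nat !intrM (rmorph_nat intr) (rmorphXn intr).
have -> : `|(g p)`_k|%:~R * `|a|%:~R ^+ k * k`!%:R * (C i * B i ^+ k / k`!%:R) =
    C i * (`|(g p)`_k|%:~R * (`|a|%:~R * B i) ^+ k) :> R.
  have : k`!%:R != 0 :> R by rewrite pnatr_eq0 -lt0n fact_gt0.
  by move: (k`!%:R) => f f0; rewrite exprMn; field.
rewrite ler_wpM2l // ler_wpM2l ?ler0z // lerXn2r ?nnegrE ?mulr_ge0 ?ler0z //.
rewrite ler_wpM2l ?ler0z //.
by rewrite (bigD1 i) //= lerDl sumr_ge0.
Qed.

Lemma sum_cexp_neq0 : m%:R + \sum_(i | P i) cexp (beta i) != 0.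
Proof.
apply/negP => /eqP sum0; have [C [D err]] := error.
have [n0 _ big] := expr_lt_fact C D.
pose n := (n0 + m + `|a| + `|(T`_0)%R|)%N.
have [p np p_prime] := prime_above n.
have mp : (m < p)%N by rewrite (leq_ltn_trans _ np) // /n; lia.
have ap : (`|a| < p)%N by rewrite (leq_ltn_trans _ np) // /n; lia.
have Tp : (`|(T`_0)%R| < p)%N by rewrite (leq_ltn_trans _ np) // /n; lia.
have /big : (n0 <= p.-1)%N by move: np; rewrite /n; lia.
have := int_part p_prime mp ap Tp.
have -> : m%:R * (hermite a (g p) 0)%:~R +
    \sum_(i | P i) hermite a%:~R (map_poly intr (g p)) (sigma i) =
   - (\sum_(i | P i) (cexp (beta i) * (hermite a (g p) 0)%:~R -
      hermite a%:~R (map_poly intr (g p)) (sigma i))).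
  move/eqP: sum0; rewrite addr_eq0 => /eqP ->.
  by rewrite sumrB -mulr_suml opprB mulNr addrC.
rewrite normrN => /le_trans /(_ (err _ (prime_gt0 p_prime))).
by rewrite -(rmorph_nat (real_complex R)) lecR => /le_lt_trans h /h; rewrite ltxx.
Qed.

End LindemannSum.

(** * Transcendence of pi *)

(** If q has degree d and leading coefficient a, then a^(d-1) q(X / a) is monic
    with integer coefficients and has the root a x. *)
Lemma monic_int_multiple (K : numFieldType) (x : K) :
  algebraicOver (ratr : rat -> K) x ->
  exists a : int, exists P : {poly int},
    [/\ a != 0, P \is monic & root (map_poly intr P) (a%:~R * x)].
Proof.
case=> p0 p0n0 p0x; have [q [c c0 pE]] := rat_poly_scale p0.
have qx : root (map_poly intr q) x.
  move: p0x; rewrite pE linearZ /= /root hornerZ mulf_eq0 fmorph_eq0 invr_eq0.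
  rewrite intr_eq0 (negbTE c0) /= -map_poly_comp.
  by congr (_.[x] == 0); apply: eq_map_poly => k /=; rewrite ratr_int.
have q0 : q != 0.
  by apply: contra p0n0 => /eqP q0; rewrite pE q0 rmorph0 scaler0.
pose d := (size q).-1; pose a := lead_coef q.
have sq : size q = d.+1 by rewrite prednK // size_poly_gt0.
have a0 : a != 0 by rewrite lead_coef_eq0.
have qd : q`_d = a by [].
pose E k : int := if (k < d)%N then q`_k * a ^+ (d.-1 - k) else 1.
have sP : size (\poly_(k < d.+1) E k) = d.+1.
  by apply: size_poly_eq; rewrite /E ltnn oner_eq0.
exists a, (\poly_(k < d.+1) E k); split=> //.
  by rewrite monicE lead_coefE sP coef_poly ltnSn /E ltnn.
rewrite /root (@horner_coef_wide _ d.+1) ?(leq_trans (size_poly _ _)) ?sP //.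
rewrite big_ord_recr /= coef_map coef_poly ltnSn /E ltnn mul1r.
move: qx; rewrite /root (@horner_coef_wide _ d.+1); last by rewrite (leq_trans (size_poly _ _)) ?sq.
rewrite big_ord_recr /= coef_map qd => /eqP qx.
case: (posnP d) => [d0|d_gt0].
  by move/eqP: qx; rewrite d0 big_ord0 add0r mulr1 intr_eq0 (negbTE a0).
have -> : (a%:~R * x) ^+ d = a%:~R ^+ d.-1 * (a%:~R * x ^+ d) :> K.
  by rewrite exprMn mulrA -exprSr prednK.
have -> : a%:~R * x ^+ d = - (\sum_(i < d) (map_poly intr q)`_i * x ^+ i) :> K.
  by apply/eqP; rewrite -addr_eq0 addrC qx.
rewrite mulrN mulr_sumr -sumrB big1 // => i _.
rewrite !coef_map coef_poly ltnS ltnW // /E ltn_ord /= intrM (rmorphXn intr) exprMn.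
have -> : a%:~R ^+ d.-1 = a%:~R ^+ (d.-1 - i) * a%:~R ^+ i :> K.
  by rewrite -exprD subnK // -ltnS prednK.
by apply/eqP; rewrite subr_eq0; apply/eqP; ring.
Qed.

Section PiTranscendental.
Local Open Scope complex_scope.
Variable R : realType.

Lemma algebraic_i_pi : algebraicOver (ratr : rat -> R) pi ->
  algebraicOver (ratr : rat -> R[i]) (0 +i* pi).
Proof.
move=> api; have -> : 0 +i* pi = 'i * pi%:C :> R[i].
  by apply/eqP; rewrite eq_complex /=; apply/andP; split; apply/eqP; ring.
apply: algebraic_mul.
  exists ('X^2 + 1); first by rewrite -size_poly_eq0 -['X^2 + 1]/('X^2 + 1%:P) size_XnaddC.
  rewrite rmorphD rmorph1 /= map_polyXn /root hornerD hornerXn hornerC.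
  by rewrite expr2 eq_complex /=; apply/andP; split; apply/eqP; ring.
case: api => p p0 px; exists p => //.
have -> : map_poly (ratr : rat -> R[i]) p = map_poly (real_complex R) (map_poly ratr p).
  rewrite -map_poly_comp; apply: eq_map_poly => k /=.
  by rewrite [RHS](fmorph_eq_rat (real_complex R \o ratr)).
by move: px; rewrite /root horner_map fmorph_eq0.
Qed.

(** Lindemann's argument.  If i pi is algebraic, some nonzero integer multiple
    a i pi is a root of a monic integer polynomial with roots c_j.  The product
    of the factors 1 + e^(c_j / a) vanishes, because e^(i pi) = -1; expanded, it
    is the sum of e^(s_A / a) over the sums s_A of the subsets A of the roots.
    The m subsets with s_A = 0 contribute the integer m > 0, the other s_A are
    the roots of an integer polynomial that does not vanish at 0, and
    [sum_cexp_neq0] says that the total is not 0. *)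
Theorem pi_transcendental : ~ algebraicOver (ratr : rat -> R) pi.
Proof.
move=> /algebraic_i_pi /monic_int_multiple[a [P [a0 Pm Pw]]].
have ac0 : a%:~R != 0 :> R[i] by rewrite intr_eq0.
have [s sP] := closed_field_poly_normal (map_poly intr P : {poly R[i]}).
have {}sP : \prod_(c <- in_tuple s) ('X - c%:P) = map_poly intr P :> {poly R[i]}.
  by rewrite [RHS]sP (monicP (monic_map _ Pm)) scale1r.
pose cs := in_tuple s; pose S := subset_sum cs.
have [Q QE] := prod_subset_sums_int sP.
pose zero A := S A == 0.
pose m := #|[pred A | zero A]|.
have m_gt0 : (0 < m)%N.
  by apply/card_gt0P; exists finset.set0; rewrite !inE /zero /S /subset_sum big_set0.
pose T := drop_poly m Q.
have QT : map_poly intr Q = 'X^m * \prod_(A | ~~ zero A) ('X - (S A)%:P) :> {poly R[i]}.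
  rewrite -QE (bigID zero) /=; congr (_ * _).
  rewrite (eq_bigr (fun=> 'X)) => [|A /eqP SA]; last by rewrite -[subset_sum _ A]/(S A) SA subr0.
  by rewrite prodr_const.
have TE : map_poly intr T = \prod_(A | ~~ zero A) ('X - (S A)%:P) :> {poly R[i]}.
  apply/polyP => k; rewrite coef_map coef_drop_poly -coef_map QT coefXnM.
  by rewrite ltnNge leq_addl addnK.
have T0 : T`_0 != 0.
  rewrite -(intr_eq0 R[i]) -coef_map TE -horner_coef0 horner_prod.
  apply/prodf_neq0 => A; rewrite /zero !hornerE; by rewrite oppr_eq0.
have rootT A : ~~ zero A -> (map_poly intr T).[S A] = 0.
  by move=> zA; rewrite TE horner_prod (bigD1 A) //= !hornerE subrr mul0r.
have symT (G : {poly int}) :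
    exists z : int, \sum_(A | ~~ zero A) (map_poly intr G).[S A] = z%:~R.
  have [z zE] := sum_subset_sums_int sP G.
  (* Each of the m subsets of sum 0 contributes G(0) to the sum over all subsets. *)
  exists (z - G`_0 *+ m); rewrite intrB -zE [in RHS](bigID zero) /=.
  rewrite [X in _ = X + _ - _](eq_bigr (fun=> (G`_0)%:~R)) => [|A /eqP SA].
    by rewrite sumr_const (rmorphMn intr) [RHS]addrAC subrr add0r.
  by rewrite -[subset_sum _ A]/(S A) SA horner_coef0 coef_map.
have := sum_cexp_neq0 a0 m_gt0 T0 rootT symT; apply/negP; rewrite negbK.
have prod0 : \prod_(j < size s) (cexp (tnth cs j / a%:~R) + 1) = 0.
  have : a%:~R * (0 +i* pi) \in s.
    by move: Pw; rewrite -sP root_prod_XsubC.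
  case/(tnthP cs) => j jE; apply/eqP/prodf_eq0; exists j => //.
  by rewrite -jE mulrC mulKf // cexp_pi addNr.
apply/eqP; rewrite -[RHS]prod0 bigA_distr [RHS](bigID zero) /=; congr (_ + _).
  rewrite [RHS](eq_bigr (fun=> 1)) ?sumr_const // => A /eqP SA.
  by rewrite -big_mkcond -cexp_sum -mulr_suml -/(subset_sum cs A) -/(S A) SA mul0r cexp0.
apply: eq_bigr => A _.
by rewrite -big_mkcond -cexp_sum -mulr_suml.
Qed.
End PiTranscendental.

(** * Integrals over the half-line and derivatives of the Euler integral *)

Section HalfLine.
Variable R : realType.
Local Notation mu := (@lebesgue_measure R).
Local Notation D := (`]0, +oo[%classic : set R).

(** Compact intervals that exhaust the half-line: they stay away from 0, where
    ln and the powers are singular. *)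
Definition shell n : set R := `[n.+2%:R^-1, n.+2%:R].

Lemma bigcup_shell : \bigcup_n shell n = D.
Proof.
apply/seteqP; split => [t [n _]|t]; rewrite /shell /= !in_itv /=.
  by move=> /andP[nt _]; rewrite andbT (lt_le_trans _ nt) // invr_gt0.
rewrite andbT => t0; have s0 : 0 <= t + t^-1 by rewrite addr_ge0 ?invr_ge0 // ltW.
have le : t + t^-1 <= (Num.truncn (t + t^-1)).+2%:R.
  by rewrite (le_trans (ltW (truncnS_gt _))) // ler_nat.
exists (Num.truncn (t + t^-1)) => //=; rewrite in_itv /=; apply/andP; split.
  by rewrite invf_ple ?posrE // (le_trans _ le) // lerDr ltW.
by rewrite (le_trans _ le) // lerDl invr_ge0 ltW.
Qed.

Lemma shell_subset n : shell n `<=` D.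
Proof. by rewrite -bigcup_shell => t nt; exists n. Qed.

Lemma cvg_integral_shell (f : R -> R) :
  (forall t : R, 0 < t -> 0 <= f t) -> measurable_fun D f ->
  (\int[mu]_(t in shell n) (f t)%:E @[n --> \oo] --> \int[mu]_(t in D) (f t)%:E)%E.
Proof.
move=> f0 mf; rewrite -bigcup_shell.
apply: (@ge0_nondecreasing_set_cvg_integral _ (measurableTypeR R) R shell (EFin \o f)
  lebesgue_measure).
- move=> m n mn; rewrite subsetEset => t; rewrite /shell /= !in_itv /= => /andP[a b].
  apply/andP; split; last by rewrite (le_trans b) // ler_nat !ltnS.
  by rewrite (le_trans _ a) // lef_pV2 ?posrE // ler_nat !ltnS.
- by move=> n; exact: measurable_itv.
- move=> n; apply/measurable_EFinP; apply: measurable_funS mf; first exact: measurable_itv.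
  exact: shell_subset.
- by move=> n t /shell_subset /=; rewrite in_itv /= andbT lee_fin => /f0.
Qed.

Lemma integral_shell (f F : R -> R) n :
  (forall t : R, 0 < t -> is_derive t 1 F (f t)) ->
  (forall t : R, 0 < t -> {for t, continuous f}) ->
  (\int[mu]_(t in shell n) (f t)%:E = (F n.+2%:R - F n.+2%:R^-1)%:E)%E.
Proof.
move=> dF cf; rewrite EFinB.
have n0 : 0 < n.+2%:R^-1 :> R by rewrite invr_gt0.
have cF t : 0 < t -> {for t, continuous F}.
  move=> t0; apply/differentiable_continuous/derivable1_diffP.
  by have [] := dF _ t0.
apply: continuous_FTC2.
- by rewrite (lt_trans _ (_ : 1 < _)) ?invf_lt1 ?ltr1n.
- apply: continuous_in_subspaceT => t /[!inE] /=; rewrite in_itv /= => /andP[nt _].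
  exact/cf/(lt_le_trans n0).
- split.
  + by move=> t; rewrite in_itv /= => /andP[nt _]; have [] := dF t (lt_trans n0 nt).
  + exact/cvg_at_right_filter/cF.
  + exact/cvg_at_left_filter/cF.
- move=> t; rewrite in_itv /= => /andP[nt _].
  have d := dF t (lt_trans n0 nt); by rewrite derive1E derive_val.
Qed.

Lemma integrable_of_primitive (f F : R -> R) (M : R) :
  (forall t : R, 0 < t -> 0 <= f t) ->
  (forall t : R, 0 < t -> is_derive t 1 F (f t)) ->
  (forall t : R, 0 < t -> {for t, continuous f}) ->
  (forall t : R, 0 < t -> `|F t| <= M) ->
  mu.-integrable D (EFin \o f).
Proof.
move=> f0 dF cf FM.
have mf : measurable_fun D f.
  apply: open_continuous_measurable_fun; first exact: interval_open.
  by move=> t /[!inE] /=; rewrite in_itv /= andbT => /cf.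
apply/integrableP; split; first exact/measurable_EFinP.
have -> : (\int[mu]_(t in D) `|(EFin \o f) t| = \int[mu]_(t in D) (f t)%:E)%E.
  apply: eq_integral => t /[!inE] /=; rewrite in_itv /= andbT => /f0 ft.
  by rewrite ger0_norm.
apply: (@le_lt_trans _ _ (M + M)%:E); last by rewrite ltry.
apply: (cvge_le _ (cvg_integral_shell f0 mf)).
apply: nearW => n; rewrite (integral_shell n dF cf) lee_fin.
rewrite (le_trans (ler_norm _)) // (le_trans (ler_normB _ _)) //.
by rewrite lerD ?FM // invr_gt0.
Qed.

Lemma is_derive_expR_ln (p t : R) : 0 < t ->
  is_derive t 1 (fun s => expR (p * ln s)) (p * expR ((p - 1) * ln t)).
Proof.
move=> t0; have dl := is_derive1_ln t0.
have dpl : is_derive t 1 (fun s => p * ln s) (p * t^-1) by exact: is_deriveZ.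
apply: (is_derive_eq (@is_derive1_comp _ expR _ t _ _ (is_derive_expR _) dpl)).
rewrite mulrBl mul1r expRD expRN lnK ?posrE //; ring.
Qed.

Lemma expR_ge_expn (x : R) n : 0 <= x -> x ^+ n <= n`!%:R * expR x.
Proof.
move=> x0; case: n => [|n]; first by rewrite expr0 mul1r (le_trans _ (expR_ge1Dx x)) // lerDl.
rewrite -ler_pdivrMl ?ltr0n ?fact_gt0 // mulrC.
by rewrite (le_trans _ (expR_ge1Dxn n x0)) // lerDr.
Qed.

Lemma measurable_expR_ln (p : R) : measurable_fun D (fun t => expR (p * ln t)).
Proof.
apply: measurableT_comp => //; apply: measurable_funM; first exact: measurable_cst.
by apply: measurable_funS (@measurable_ln R).
Qed.

Lemma measurable_expRN : measurable_fun D (fun t : R => expR (- t)).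
Proof. by apply: measurableT_comp => //; exact: measurableT_comp. Qed.

(** The derivative p t^(p-1) / (1 + t^p)^2 of -1 / (1 + t^p) is integrable
    because its primitive is bounded, and it dominates t^(p-1) e^(-t) because
    (1 + t^p)^2 e^(-t) is bounded. *)
Lemma integrable_expR_ln (p : R) : 0 < p ->
  mu.-integrable D (EFin \o (fun t => expR ((p - 1) * ln t) * expR (- t))).
Proof.
move=> p0; pose u t := expR (p * ln t).
have u1 t : 0 < 1 + u t by rewrite addr_gt0 ?expR_gt0.
pose f t := p * expR ((p - 1) * ln t) * (1 + u t) ^- 2.
pose F t := - (1 + u t)^-1.
have dF (t : R) : 0 < t -> is_derive t 1 F (f t).
  move=> t0; have d1 := is_deriveD (is_derive_cst (1 : R) t 1) (is_derive_expR_ln p t0).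
  have d2 := is_deriveN (is_deriveV (lt0r_neq0 (u1 t) : (cst 1 + u) t != 0) d1).
  apply: (is_derive_eq d2); rewrite add0r scaleNr opprK.
  by rewrite /f [RHS]mulrC.
have cf (t : R) : 0 < t -> {for t, continuous f}.
  move=> t0.
  have cu (a : R) : {for t, continuous (fun s => expR (a * ln s))}.
    apply/differentiable_continuous/derivable1_diffP.
    by have [] := is_derive_expR_ln a t0.
  apply: cvgM; first by apply: cvgM; [exact: cvg_cst|exact: cu].
  apply: cvgV; first by rewrite expf_neq0 // lt0r_neq0.
  by apply: cvgM; apply: cvgD; [exact: cvg_cst|exact: cu|exact: cvg_cst|exact: cu].
have f0 (t : R) : 0 < t -> 0 <= f t.
  by move=> _; rewrite !mulr_ge0 ?expR_ge0 ?invr_ge0 ?exprn_ge0 // ltW.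
have FM (t : R) : 0 < t -> `|F t| <= 1.
  move=> _; rewrite normrN ger0_norm ?invr_ge0 ?(ltW (u1 t)) //.
  by rewrite invf_le1 ?u1 // lerDl expR_ge0.
have intf := integrable_of_primitive f0 dF cf FM.
pose N := (Num.truncn (2 * p)).+1.
pose C := (4 + 2 * N`!%:R) / p.
apply: (le_integrable _ _ _ (integrableZl _ C intf)) => //.

- apply/measurable_EFinP; apply: measurable_funM; last exact: measurable_expRN.
  exact: measurable_expR_ln.
- move=> t /=; rewrite in_itv /= andbT => t0.
  rewrite lee_fin [leLHS]ger0_norm ?mulr_ge0 ?expR_ge0 //.
  rewrite ger0_norm; last by rewrite mulr_ge0 ?f0 // divr_ge0 ?(ltW p0) // addr_ge0 ?mulr_ge0.
  have -> : C * f t = expR ((p - 1) * ln t) * ((4 + 2 * N`!%:R) / (1 + u t) ^+ 2).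
    by rewrite /C /f; field; rewrite !lt0r_neq0.
  rewrite ler_wpM2l ?expR_ge0 // expRN ler_pdivlMr ?exprn_gt0 //.
  rewrite mulrC ler_pdivrMr ?expR_gt0 //.
  (* u t ^+ 2 is t^(2p): at most 1 for t <= 1, and at most t^N <= N! e^t for t > 1. *)
  have uN : u t ^+ 2 <= 1 + N`!%:R * expR t.
    rewrite /u -expRM_natl; have [t1|t1] := leP t 1.
      rewrite (@le_trans _ _ 1) ?lerDl ?mulr_ge0 ?expR_ge0 // -[leRHS]expR0 ler_expR.
      by rewrite mulr_ge0_le0 // mulr_ge0_le0 ?ln_le0 ?(ltW p0).
    rewrite (@le_trans _ _ (N`!%:R * expR t)) ?lerDr //.
    apply: le_trans (expR_ge_expn N (ltW t0)).
    rewrite -[in leRHS](@lnK _ t) ?posrE //.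
    rewrite -expRM_natl ler_expR mulrA ler_wpM2r ?ln_ge0 ?(ltW t1) //.
    by rewrite (ltW (truncnS_gt _)).
  have e1 : 1 <= expR t by rewrite -expR0 ler_expR ltW.
  have := expR_ge0 (p * ln t); rewrite -/(u t).
  have : 0 <= N`!%:R :> R by [].
  nra.
Qed.

(** The n-th derivative in x of the integrand t^(x-1) e^(-t) of Gamma, with the
    power written as an exponential, so that the formula is smooth in x. *)
Definition gker n (x t : R) : R := expR ((x - 1) * ln t) * ln t ^+ n * expR (- t).

Let dom (p q t : R) := expR ((p - 1) * ln t) * expR (- t) + expR ((q - 1) * ln t) * expR (- t).

Let integrable_dom (p q c : R) : 0 < p -> 0 < q ->
  mu.-integrable D (EFin \o (fun t => c * dom p q t)).
Proof.
move=> p0 q0; have ip := integrable_expR_ln p0; have iq := integrable_expR_ln q0.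
by apply: (integrableZl _ c (integrableD _ ip iq)).
Qed.

(** The logarithms are paid for by a small power: (d |ln t|)^n <= n! e^(d |ln t|),
    which is n! t^d or n! t^(-d).  The bound is uniform in x between p + d and
    q - d, as needed for differentiating under the integral. *)
Lemma norm_gker_le n (p q d x t : R) :
  0 < d -> p + d <= x -> x + d <= q -> 0 < t ->
  `|gker n x t| <= n`!%:R / d ^+ n * dom p q t.
Proof.
move=> d0 px xq t0; rewrite /gker /dom -mulrDl mulrA normrM [X in _ * X]ger0_norm ?expR_ge0 //.
rewrite ler_wpM2r ?expR_ge0 // normrM ger0_norm ?expR_ge0 // normrX.
have : (d * `|ln t|) ^+ n <= n`!%:R * expR (d * `|ln t|).
  by apply: expR_ge_expn; rewrite mulr_ge0 // ltW.
rewrite exprMn -ler_pdivlMl ?exprn_gt0 // mulrA [_^-1 * _]mulrC => lnn.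
apply: (le_trans (ler_wpM2l (expR_ge0 _) lnn)); rewrite mulrCA -expRD.
rewrite ler_wpM2l ?divr_ge0 ?exprn_ge0 ?(ltW d0) //.
have [l0|l0] := leP 0 (ln t).
  rewrite (@le_trans _ _ (expR ((q - 1) * ln t))) ?lerDr ?expR_ge0 //.
  by rewrite ler_expR ger0_norm //; nra.
rewrite (@le_trans _ _ (expR ((p - 1) * ln t))) ?lerDl ?expR_ge0 //.
by rewrite ler_expR ltr0_norm //; nra.
Qed.

Lemma measurable_gker n x : measurable_fun D (gker n x).
Proof.
apply: measurable_funM; last exact: measurable_expRN.
apply: measurable_funM; first exact: measurable_expR_ln.
by apply: measurable_funX; apply: measurable_funS (@measurable_ln R).
Qed.

Lemma integrable_gker n x : 0 < x -> mu.-integrable D (EFin \o gker n x).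
Proof.
move=> x0; have d0 : 0 < x / 2 by rewrite divr_gt0.
have ix := @integrable_dom (x / 2) (x + x / 2) (n`!%:R / (x / 2) ^+ n) d0 (addr_gt0 x0 d0).
apply: (le_integrable _ _ _ ix) => //.
  by apply/measurable_EFinP; exact: measurable_gker.
move=> t /=; rewrite in_itv /= andbT => t0; rewrite lee_fin.
apply: le_trans (ler_norm _); apply: norm_gker_le => //; lra.
Qed.

(** The n-th derivative of Gamma on the positive half-line, see [is_derive_gjet]. *)
Definition gjet n x := \int[mu]_(t in D) gker n x t.

Lemma is_derive_gker n (x t : R) : is_derive x 1 (fun y => gker n y t) (gker n.+1 x t).
Proof.
pose c := ln t ^+ n * expR (- t).
have -> : (fun y => gker n y t) = (fun y : R => expR ((y - 1) * ln t)) * cst c.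
  by apply/funext => y; rewrite /gker fctE -mulrA.
have d1 : is_derive x 1 (fun y : R => (y - 1) * ln t) (ln t).
  have -> : (fun y : R => (y - 1) * ln t) = (id - cst 1) * cst (ln t) by [].
  by apply: is_derive_eq; rewrite subr0 scaler0 add0r [LHS]mulr1.
have d2 := @is_derive1_comp _ expR _ x _ _ (is_derive_expR _) d1.
apply: (is_derive_eq (is_deriveM d2 (is_derive_cst c x 1))).
rewrite scaler0 add0r /gker exprS [LHS](_ : _ = c * (expR ((x - 1) * ln t) * ln t)) // /c; ring.
Qed.

Lemma is_derive_gjet n (x : R) : 0 < x -> is_derive x 1 (gjet n) (gjet n.+1 x).
Proof.
move=> x0; pose u := x - x / 4; pose v := x + x / 4.
have Ix : `]u, v[%classic x by rewrite /= in_itv /= /u /v; apply/andP; split; lra.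
have Igt y : `]u, v[%classic y -> 0 < y.
  by rewrite /= in_itv /= /u /v => /andP[]; lra.
have pE y t : partial1of2 (gker n) y t = gker n.+1 y t.
  by rewrite partial1of2E (@derive_val _ _ _ _ _ _ _ (is_derive_gker n y t)).
pose p := x / 2; pose q := 2 * x; pose d := x / 4.
pose c := n.+1`!%:R / d ^+ n.+1.
have [p0 q0 d0] : [/\ 0 < p, 0 < q & 0 < d] by rewrite /p /q /d; split; lra.
have domG t : 0 <= c * dom p q t.
  rewrite mulr_ge0 ?divr_ge0 ?exprn_ge0 ?(ltW d0) //.
  by rewrite addr_ge0 ?mulr_ge0 ?expR_ge0.
have Gub y t : `]u, v[%classic y -> D t -> `|partial1of2 (gker n) y t| <= c * dom p q t.
  rewrite pE /= !in_itv /= andbT => /andP[uy yv] t0.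
  by apply: norm_gker_le => //; move: uy yv; rewrite /p /q /d /u /v; lra.
have int y Iy := integrable_gker n (Igt y Iy).
have der y t : `]u, v[%classic y -> D t -> derivable (gker n ^~ t) y 1.
  by move=> _ _; have [] := is_derive_gker n y t.
have ig := integrable_dom c p0 q0.
have dG : derivable (gjet n) x 1.
  exact: (derivable_under_integral _ Ix int der domG ig Gub).
have eG : derive1 (gjet n) x = \int[mu]_(t in D) partial1of2 (gker n) x t.
  exact: (differentiation_under_integral _ Ix int der domG ig Gub).
apply: DeriveDef => //; rewrite -derive1E eG.
by apply: eq_Rintegral => t _; rewrite pE.
Qed.

End HalfLine.

(** * Functional equation and log-convexity of the Euler integral *)

Section EulerIntegral.
Variable R : realType.
Local Notation mu := (@lebesgue_measure R).
Local Notation D := (`]0, +oo[%classic : set R).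

Lemma cvg_Rintegral_shell (f : R -> R) :
  (forall t : R, 0 < t -> 0 <= f t) -> mu.-integrable D (EFin \o f) ->
  \int[mu]_(t in @shell R n) f t @[n --> \oo] --> \int[mu]_(t in D) f t.
Proof.
move=> f0 intf; have /integrableP[/measurable_EFinP mf _] := intf.
apply: fine_cvg; rewrite fineK; first exact: cvg_integral_shell.
exact: integrable_fin_num.
Qed.

(** The fundamental theorem of calculus on the half-line for an integrand given
    as a difference of nonnegative functions: the convergence of the integrals
    over the shells is then monotone for each of them. *)
Lemma Rintegral_primitive (f g F : R -> R) (l : R) :
  (forall t : R, 0 < t -> 0 <= f t) -> mu.-integrable D (EFin \o f) ->
  (forall t : R, 0 < t -> 0 <= g t) -> mu.-integrable D (EFin \o g) ->
  (forall t : R, 0 < t -> is_derive t 1 F (f t - g t)) ->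
  (forall t : R, 0 < t -> {for t, continuous f}) ->
  (forall t : R, 0 < t -> {for t, continuous g}) ->
  F n.+2%:R - F n.+2%:R^-1 @[n --> \oo] --> l ->
  \int[mu]_(t in D) f t - \int[mu]_(t in D) g t = l.
Proof.
move=> f0 intf g0 intg dF cf cg Fl.
have sub (h : R -> R) n : mu.-integrable D (EFin \o h) ->
    mu.-integrable (@shell R n) (EFin \o h).
  move=> ih; apply: integrableS ih; [by []|exact: measurable_itv|exact: shell_subset].
have E n : \int[mu]_(t in @shell R n) f t - \int[mu]_(t in @shell R n) g t =
    F n.+2%:R - F n.+2%:R^-1.
  rewrite -RintegralB //; [|exact: measurable_itv|exact: sub|exact: sub].
  by rewrite /Rintegral (integral_shell n dF) // => t t0; apply: cvgB; [exact: cf|exact: cg].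
have c : F n.+2%:R - F n.+2%:R^-1 @[n --> \oo] -->
    \int[mu]_(t in D) f t - \int[mu]_(t in D) g t.
  under eq_cvg do rewrite -E.
  exact: (cvgB (cvg_Rintegral_shell f0 intf) (cvg_Rintegral_shell g0 intg)).
exact: (cvg_unique _ c Fl).
Qed.

Lemma cvg_pow_at_0 (x : R) : 0 < x ->
  expR (x * ln n.+2%:R^-1) @[n --> \oo] --> (0 : R).
Proof.
move=> x0; have h : n.+2%:R^-1 @[n --> \oo] --> (0 : R).
  by have := @cvg_harmonic R; rewrite -(cvg_shiftS _).
have pos n : 0 < n.+2%:R^-1 :> R by rewrite invr_gt0.
have /cvg_at_rightP/(_ (fun n => n.+2%:R^-1) (conj pos h)) := powR_cvg0 x0.
apply: cvg_trans; apply: near_eq_cvg; apply: nearW => n.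
by rewrite /powR gt_eqF.
Qed.

Lemma cvg_pow_exp (x : R) : 0 < x ->
  expR (x * ln n.+2%:R) * expR (- n.+2%:R) @[n --> \oo] --> (0 : R).
Proof.
move=> x0; pose N := (Num.truncn x).+2.
have h : N`!%:R * n.+2%:R^-1 @[n --> \oo] --> (0 : R).
  rewrite -[X in _ --> X](mulr0 N`!%:R); apply: cvgM; first exact: cvg_cst.
  by have := @cvg_harmonic R; rewrite -(cvg_shiftS _).
apply: (squeeze_cvgr _ (cvg_cst 0) h); apply: nearW => n.
set t : R := n.+2%:R; have t0 : 0 < t by [].
rewrite mulr_ge0 ?expR_ge0 //= expRN ler_pdivrMr ?expR_gt0 // mulrAC ler_pdivlMr //.
apply: le_trans (expR_ge_expn N (ltW t0)).
rewrite -[X in _ * X](lnK t0) -expRD -[in leRHS](lnK t0) -expRM_natl ler_expR.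
have t1 : 1 <= t by rewrite /t ler1n.
rewrite -[X in _ + X]mul1r -mulrDl ler_wpM2r ?ln_ge0 //.
by rewrite /N -natr1 lerD2r ltW // truncnS_gt.
Qed.

Local Notation G := (@gjet R 0).

Let gker0_ge0 (x t : R) : 0 <= gker 0 x t.
Proof. by rewrite /gker expr0 mulr1 mulr_ge0 ?expR_ge0. Qed.

Lemma is_derive_expRN (t : R) : is_derive t 1 (fun s : R => expR (- s)) (- expR (- t)).
Proof.
apply: (is_derive_eq (@is_derive1_comp _ expR -%R t _ _ (is_derive_expR _) _)).
by rewrite mulrN1.
Qed.

Lemma continuous_gker n (x t : R) : 0 < t -> {for t, continuous (gker n x)}.
Proof.
move=> t0; apply/differentiable_continuous/derivable1_diffP.
have dX := @is_deriveX _ _ _ n _ _ _ (is_derive1_ln t0).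
have [h _] := is_deriveM (is_deriveM (is_derive_expR_ln (x - 1) t0) dX) (is_derive_expRN t).
suff <- : (fun s => expR ((x - 1) * ln s)) * @ln R ^+ n * (fun s => expR (- s)) = gker n x by [].
by apply/funext => s; rewrite /gker !fctE.
Qed.

(** Integration by parts: the integrand of x Gamma(x) - Gamma(x + 1) is the
    derivative of t^x e^(-t), which vanishes at both ends. *)
Lemma gjetD1 (x : R) : 0 < x -> G (x + 1) = x * G x.
Proof.
move=> x0; apply/esym/eqP; rewrite -subr_eq0; apply/eqP.
rewrite /gjet -RintegralZl //; last exact: integrable_gker.
pose F t := expR (x * ln t) * expR (- t).
apply: (@Rintegral_primitive _ _ F).
- by move=> t _; rewrite mulr_ge0 ?(ltW x0).
- exact: (integrableZl _ x (integrable_gker 0 x0)).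
- by move=> t _.
- by apply: integrable_gker; rewrite addr_gt0.
- move=> t t0; have d1 := is_derive_expR_ln x t0.
  have d2 := is_derive_expRN t.
  apply: (is_derive_eq (is_deriveM d1 d2)).
  rewrite /gker !expr0 !mulr1 addrK -![_ *: _]/(_ * _); ring.
- move=> t t0; apply: cvgM; first exact: cvg_cst.
  exact: continuous_gker.
- by move=> t; exact: continuous_gker.
- rewrite -[X in _ --> X](subr0 0); apply: cvgB; first exact: cvg_pow_exp.
  apply: (squeeze_cvgr _ (cvg_cst 0) (cvg_pow_at_0 x0)); apply: nearW => n.
  rewrite mulr_ge0 ?expR_ge0 //= ler_piMr ?expR_ge0 //.
Qed.

Lemma gjet_ge0 (x : R) : 0 <= G x.
Proof. by apply: Rintegral_ge0 => t _; exact: gker0_ge0. Qed.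

Lemma gjet1 : G 1 = 1.
Proof.
have i0 : mu.-integrable D (EFin \o cst 0) by exact: integrable0.
have Z : \int[mu]_(t in D) (cst 0 t : R) = 0 by rewrite /Rintegral integral0.
rewrite /gjet -[LHS]subr0 -{2}Z.
apply: (@Rintegral_primitive _ _ (fun t => - expR (- t))) => //.
- by apply: integrable_gker.
- move=> t t0; apply: (is_derive_eq (is_deriveN (is_derive_expRN t))).
  by rewrite opprK subr0 /gker subrr mul0r expR0 mul1r expr0 mul1r.
- by move=> t; exact: continuous_gker.
- by move=> t _; exact: cvg_cst.
have h : n.+2%:R^-1 @[n --> \oo] --> (0 : R).
  by have := @cvg_harmonic R; rewrite -(cvg_shiftS _).
have e1 : expR (- n.+2%:R^-1) @[n --> \oo] --> (1 : R).
  have c : expR s @[s --> (0 : R)] --> (1 : R).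
    by rewrite -[X in _ --> X]expR0; exact: continuous_expR.
  have hN : - n.+2%:R^-1 @[n --> \oo] --> (0 : R).
    by rewrite -[X in _ --> X]oppr0; exact: cvgN.
  exact: (cvg_comp _ _ hN c).
have e2 : expR (- n.+2%:R) @[n --> \oo] --> (0 : R).
  apply: (squeeze_cvgr _ (cvg_cst 0) h); apply: nearW => n.
  rewrite expR_ge0 /= expRN lef_pV2 ?posrE ?expR_gt0 //.
  by rewrite (le_trans _ (expR_ge1Dx _)) // lerDr.
rewrite -[X in _ --> X](_ : - 0 - - 1 = _); last by rewrite opprK oppr0 add0r.
by apply: cvgB; apply: cvgN.
Qed.

Lemma expR_convex (x s : R) : 0 <= x <= 1 -> expR (x * s) <= 1 - x + x * expR s.
Proof.
move=> /andP[x0 x1].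
have h1 := expR_ge1Dx (- (x * s)); have h2 := expR_ge1Dx ((1 - x) * s).
have -> : 1 - x + x * expR s =
    expR (x * s) * ((1 - x) * expR (- (x * s)) + x * expR ((1 - x) * s)).
  rewrite mulrDr !mulrA ![_ * (1 - x)]mulrC ![_ * x]mulrC -!mulrA -!expRD subrr expR0 mulr1.
  by rewrite -mulrDl addrCA subrr addr0 mul1r.
by rewrite ler_peMr ?expR_ge0 //; nra.
Qed.

(** A form of the log-convexity of Gamma.  Pointwise (t / a)^x is at most
    1 - x + x (t / a), by convexity of the exponential; integrating against
    t^(a-1) e^(-t) and using Gamma(a + 1) = a Gamma(a) gives the claim. *)
Lemma gjet_le (a x : R) : 0 < a -> 0 <= x <= 1 -> G (a + x) <= expR (x * ln a) * G a.
Proof.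
move=> a0 x01; have [x0 x1] := andP x01.
have ia := integrable_gker 0 a0.
have ia1 : mu.-integrable D (EFin \o gker 0 (a + 1)) by apply: integrable_gker; rewrite addr_gt0.
have -> : expR (x * ln a) * G a =
    (expR (x * ln a) * (1 - x)) * G a + (expR (x * ln a) * x / a) * G (a + 1).
  by rewrite gjetD1 //; field; rewrite lt0r_neq0.
rewrite /gjet -!RintegralZl // -RintegralD //; last 2 first.
- exact: (integrableZl _ _ ia).
- exact: (integrableZl _ _ ia1).
apply: le_Rintegral => //.
- by apply: integrable_gker; rewrite ltr_wpDr.
- exact: (integrableD _ (integrableZl _ _ ia) (integrableZl _ _ ia1)).
move=> t /=; rewrite in_itv /= andbT => t0.
rewrite /gker !expr0 !mulr1 !mulrA -mulrDl ler_wpM2r ?expR_ge0 //.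
have -> : (a + x - 1) * ln t = x * ln a + (a - 1) * ln t + x * (ln t - ln a) by ring.
have -> : (a + 1 - 1) * ln t = (a - 1) * ln t + ln a + (ln t - ln a) by ring.
move: (ln t - ln a) => s.
rewrite !expRD [expR (ln a)]lnK ?posrE //.
set u := expR (x * ln a); set v := expR ((a - 1) * ln t).
have -> : u * (1 - x) * v + u * x / a * (v * a * expR s) =
    u * v * (1 - x + x * expR s).
  by field; rewrite lt0r_neq0.
by rewrite ler_wpM2l ?mulr_ge0 ?expR_ge0 // expR_convex.
Qed.

End EulerIntegral.

(** * Integrals of Wallis type *)

Section SineProduct.
Variable R : realType.
Local Notation mu := (@lebesgue_measure R).
Local Notation Q := (`[0, pi / 2]%classic : set R).

Lemma Rintegral_quarter (f F : R -> R) : continuous f ->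
  (forall t : R, is_derive t 1 F (f t)) ->
  \int[mu]_(t in Q) f t = F (pi / 2) - F 0.
Proof.
move=> cf dF.
have cF : continuous F.
  move=> t; apply/differentiable_continuous/derivable1_diffP.
  by have [] := dF t.
rewrite /Rintegral (@continuous_FTC2 _ f F) //.
- by rewrite divr_gt0 // pi_gt0.
- exact: continuous_subspaceT.
- split; first by move=> t _; have [] := dF t.
  + exact/cvg_at_right_filter/cF.
  + exact/cvg_at_left_filter/cF.
- by move=> t _; have d := dF t; rewrite derive1E derive_val.
Qed.

Lemma integrable_quarter (f : R -> R) : continuous f -> mu.-integrable Q (EFin \o f).
Proof.
move=> cf; apply: continuous_compact_integrable; first exact: segment_compact.
exact: continuous_subspaceT.
Qed.

(** The integrals behind Euler's product for the sine: the recursion [wallisS]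
    accumulates the factors k^2 - x^2, the value at m = 0 is sin(pi x) / (2 x),
    and the ratio to the value at x = 0 tends to 1 as m grows. *)
Definition wallis (x : R) m : R :=
  \int[mu]_(t in Q) (cos (2 * x * t) * cos t ^+ m.*2).

Let is_derive_dilate (f : R -> R) k df (t : R) :
  is_derive (k * t) 1 f df -> is_derive t 1 (fun s => f (k * s)) (df * k).
Proof.
move=> fd; apply: (@is_derive1_comp _ f (fun s => k * s)) => //.
have : is_derive t 1 (k *: id : R -> R) k; last by [].
by apply: is_derive_eq; rewrite [LHS]mulr1.
Qed.

Let is_derive_power (f : R -> R) n df (t : R) :
  is_derive t 1 f df -> is_derive t 1 (fun s => f s ^+ n) (n%:R * f t ^+ n.-1 * df).
Proof.
move=> fd; have d := @is_deriveX _ _ f n _ _ _ fd.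
suff <- : f ^+ n = (fun s => f s ^+ n) by apply: (is_derive_eq d).
by apply/funext => s; rewrite fctE.
Qed.

Let integrand (x : R) n t := cos (2 * x * t) * cos t ^+ n.

Let cont_integrand x n : continuous (integrand x n).
Proof.
move=> t; apply/differentiable_continuous/derivable1_diffP.
have d1 := @is_derive_dilate cos (2 * x) _ t (is_derive_cos _).
have d2 := @is_derive_power cos n _ t (is_derive_cos _).
by have [] := is_deriveM d1 d2.
Qed.

(** Two integrations by parts, performed at once with an explicit primitive that
    vanishes at both ends of the interval. *)
Lemma wallisS (x : R) m :
  (m.+1%:R ^+ 2 - x ^+ 2) * wallis x m.+1 =
  m.+1%:R * (m.*2.+1%:R / 2) * wallis x m.
Proof.
pose n := m.*2.+2; pose k := 2 * x.
pose F t := n%:R * (cos t ^+ n.-1 * (sin t * cos (k * t))) - k * (sin (k * t) * cos t ^+ n).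
pose f t := (n%:R ^+ 2 - k ^+ 2) * integrand x n t -
            n%:R * n.-1%:R * integrand x n.-2 t.
have dF (t : R) : is_derive t 1 F (f t).
  have dc := @is_derive_dilate cos k _ t (is_derive_cos _).
  have ds := @is_derive_dilate sin k _ t (is_derive_sin _).
  have p1 := @is_derive_power cos n.-1 _ t (is_derive_cos _).
  have p2 := @is_derive_power cos n _ t (is_derive_cos _).
  have d1 := is_deriveZ n%:R (is_deriveM p1 (is_deriveM (is_derive_sin t) dc)).
  have d2 := is_deriveZ k (is_deriveM ds p2).
  apply: (is_derive_eq (is_deriveB d1 d2)).
  rewrite /f /integrand -/k /n /= -![_ *: _]/(_ * _) !exprS.
  move: (cos t ^+ m.*2) (cos2Dsin2 t) => P cs.
  have -> : (sin * (fun s : R => cos (k * s))) t = sin t * cos (k * t) by [].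
  rewrite -[m.*2.+2%:R]natr1.
  move: m.*2.+1%:R => b; apply/eqP; rewrite -subr_eq0; apply/eqP.
  transitivity ((b + 1) * b * P * cos (k * t) * (1 - (cos t ^+ 2 + sin t ^+ 2))).
    ring.
  by rewrite cs subrr mulr0.
have cf : continuous f.
  move=> t; apply: cvgB; apply: cvgM; try exact: cvg_cst; exact: cont_integrand.
have := Rintegral_quarter cf dF.
rewrite /F /n /= mulr0 sin0 cos_pihalf !exprS !mul0r !(mulr0, mul0r, subr0).
have i1 := integrable_quarter (@cont_integrand x n).
have i2 := integrable_quarter (@cont_integrand x m.*2).
rewrite RintegralB //; last 2 first.
- exact: (integrableZl _ _ i1).
- exact: (integrableZl _ _ i2).
rewrite !RintegralZl // => /eqP; rewrite subr_eq0 => /eqP E.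
have : 4 * ((m.+1%:R ^+ 2 - x ^+ 2) * wallis x m.+1) =
    4 * (m.+1%:R * (m.*2.+1%:R / 2) * wallis x m).
  have n2 : n%:R = 2 * m.+1%:R :> R by rewrite /n -doubleS -muln2 natrM mulrC.
  transitivity ((n%:R ^+ 2 - k ^+ 2) * wallis x m.+1).
    by rewrite n2 /k; ring.
  by rewrite /wallis doubleS E /= n2; field.
have four0 : (4 : R) != 0 by rewrite pnatr_eq0.
by move=> E4; apply: (mulfI four0); rewrite -E4; ring.
Qed.

Lemma wallis0 (x : R) : x != 0 -> wallis x 0 = sin (pi * x) / (2 * x).
Proof.
move=> x0; have k0 : 2 * x != 0 by rewrite mulf_neq0 ?pnatr_eq0.
have dF (t : R) : is_derive t 1 (fun t => (2 * x)^-1 * sin (2 * x * t)) (integrand x 0 t).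
  have ds := @is_derive_dilate sin (2 * x) _ t (is_derive_sin _).
  apply: (is_derive_eq (is_deriveZ (2 * x)^-1 ds)).
  by rewrite /integrand expr0 mulr1 [LHS]mulrC mulfK.
rewrite [LHS](Rintegral_quarter (@cont_integrand x 0) dF) mulr0 sin0 mulr0 subr0 mulrC.
by congr (sin _ / _); field.
Qed.

Lemma wallis00 : wallis 0 0 = pi / 2.
Proof.
have dF (t : R) : is_derive t 1 id (integrand 0 0 t).
  apply: (is_derive_eq (is_derive_id t 1)).
  by rewrite /integrand mulr0 mul0r cos0 mul1r expr0.
by rewrite [LHS](Rintegral_quarter (@cont_integrand 0 0) dF) subr0.
Qed.

Lemma wallis_gt0 m : 0 < wallis 0 m.
Proof.
elim: m => [|m IH]; first by rewrite wallis00 divr_gt0 // pi_gt0.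
rewrite -(pmulr_rgt0 _ (_ : 0 < m.+1%:R ^+ 2 - 0 ^+ 2)).
  by rewrite wallisS !mulr_gt0.
by rewrite expr0n subr0 exprn_gt0.
Qed.

Lemma wallis_le (x : R) m : wallis x m <= wallis 0 m.
Proof.
have ix := integrable_quarter (@cont_integrand x m.*2).
have i0 := integrable_quarter (@cont_integrand 0 m.*2).
apply: le_Rintegral => // t _; rewrite mulr0 mul0r cos0.
by rewrite ler_wpM2r ?cos_le1 // -mul2n exprM exprn_ge0 ?sqr_ge0.
Qed.

(** Since 1 - cos(2 x t) = 2 sin^2(x t) <= 2 sin^2 t = 2 - 2 cos^2 t, the
    integral at x is at least 2 wallis 0 m.+1 - wallis 0 m, which the recursion
    evaluates. *)
Lemma wallis_ge (x : R) m : 0 <= x <= 1 ->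
  m%:R / m.+1%:R * wallis 0 m <= wallis x m.
Proof.
move=> /andP[x0 x1].
have ix := integrable_quarter (@cont_integrand x m.*2).
have i0 := integrable_quarter (@cont_integrand 0 m.*2).
have i1 := integrable_quarter (@cont_integrand 0 m.+1.*2).
have -> : m%:R / m.+1%:R * wallis 0 m = 2 * wallis 0 m.+1 - wallis 0 m.
  have := wallisS 0 m; rewrite expr0n subr0 => E.
  have m1 : m.+1%:R != 0 :> R by rewrite pnatr_eq0.
  have -> : wallis 0 m.+1 = (m.*2.+1%:R / 2) / m.+1%:R * wallis 0 m.
    by apply: (mulfI (expf_neq0 2 m1)); rewrite E; field.
  rewrite -!natr1 -muln2 natrM; move: m1; rewrite -natr1 => m1; field.
  by rewrite m1.
rewrite /wallis -RintegralZl // -RintegralB //; last exact: (integrableZl _ _ i1).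
apply: le_Rintegral => //.
  exact: (integrableB _ (integrableZl _ _ i1) i0).
move=> t /=; rewrite in_itv /= => /andP[t0 t1].
have P0 : 0 <= cos t ^+ m.*2 by rewrite -mul2n exprM exprn_ge0 ?sqr_ge0.
rewrite mulr0 mul0r cos0 !mul1r doubleS !exprS mulrA -{2}[cos t ^+ m.*2]mul1r.
rewrite mulrA -mulrBl ler_wpM2r //.
have -> : 2 * x * t = (x * t) *+ 2 by rewrite mulr2n; ring.
rewrite cos_mulr2n -mulrA -expr2 !cos2sin2.
have : sin (x * t) ^+ 2 <= sin t ^+ 2; last by rewrite -mulr_natl; lra.
have t2 : t <= pi by rewrite (le_trans t1) // ler_pdivrMr // mulr_natr mulr2n lerDl pi_ge0.
have xt : x * t <= t by rewrite ler_piMl.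
have xt0 : 0 <= x * t by rewrite mulr_ge0.
rewrite lerXn2r ?nnegrE ?sin_ge0_pi ?xt0 ?t0 ?t2 ?(le_trans xt) //.
have pi0 := pi_ge0 R.
move: xt; rewrite !le_eqVlt => /orP[/eqP->|xt]; first by rewrite eqxx.
by rewrite ltr_sin ?xt ?orbT // in_itv /=; apply/andP; split; lra.
Qed.

End SineProduct.

(** * Euler's reflection formula *)

Section Reflection.
Variable R : realType.
Local Notation G := (@gjet R 0).

Lemma gjet_fact m : G m.+1%:R = m`!%:R.
Proof.
elim: m => [|m IH]; first by rewrite gjet1.
by rewrite -natr1 gjetD1 ?ltr0n // IH factS natrM.
Qed.

Lemma gjet_prod (x : R) m : -1 < x < 1 ->
  G (m.+1%:R + x) * G (m.+1%:R - x) =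
  G (1 + x) * G (1 - x) * \prod_(k < m) (k.+1%:R ^+ 2 - x ^+ 2).
Proof.
move=> /andP[x0 x1]; elim: m => [|m IH]; first by rewrite big_ord0 mulr1.
have p1 : 0 < m.+1%:R + x.
  by rewrite (lt_le_trans _ (_ : 1 + x <= _)) ?lerD2r ?ler1n // -ltrBlDl sub0r.
have p2 : 0 < m.+1%:R - x by rewrite subr_gt0 (lt_le_trans x1) // ler1n.
rewrite big_ord_recr /= mulrA -IH -[m.+2%:R]natr1.
have -> : m.+1%:R + 1 + x = (m.+1%:R + x) + 1 by ring.
have -> : m.+1%:R + 1 - x = (m.+1%:R - x) + 1 by ring.
by rewrite (gjetD1 p1) (gjetD1 p2); ring.
Qed.

(** [gjet_le] bounds Gamma(m + 1 + x) and Gamma(m + 1 - x) from above by m! times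
    powers whose exponents are x and -x, so that only ((m + 1) / m)^x is left of
    these powers in the product. *)
Lemma gjet_prod_le (x : R) m : 0 <= x <= 1 -> (0 < m)%N ->
  G (m.+1%:R + x) * G (m.+1%:R - x) <= m.+1%:R / m%:R * m`!%:R ^+ 2.
Proof.
move=> /andP[x0 x1]; case: m => // m _; set r : R := m.+1%:R.
have r0 : 0 < r by rewrite ltr0n.
have rM : m.+2%:R = r + 1 by rewrite natr1.
have rM0 : 0 < r + 1 by rewrite addr_gt0.
have u1 : G (r + 1 + x) <= expR (x * ln (r + 1)) * G (r + 1).
  by apply: gjet_le; rewrite ?x0.
have u2 : G (r + 1 - x) <= expR (- (x * ln r)) * G (r + 1).
  have -> : r + 1 - x = r + (1 - x) by ring.
  rewrite gjetD1 // -{3}[r](@lnK R) ?posrE // mulrA -expRD.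
  have -> : - (x * ln r) + ln r = (1 - x) * ln r by ring.
  apply: gjet_le => //; lra.
rewrite rM (le_trans (ler_pM (gjet_ge0 _) (gjet_ge0 _) u1 u2)) // {u1 u2}.
rewrite -rM gjet_fact mulrACA -expRD -expr2 ler_wpM2r ?sqr_ge0 // rM.
have -> : x * ln (r + 1) + - (x * ln r) = x * (ln (r + 1) - ln r) by ring.
apply: le_trans (expR_convex _ _) _; first by rewrite x0.
rewrite expRD expRN !lnK ?posrE //.
have : 1 <= (r + 1) / r by rewrite ler_pdivlMr // mul1r lerDl.
by move: ((r + 1) / r) => w w1; nra.
Qed.

(** The same as [gjet_prod_le], with [gjet_le] applied in the opposite direction,
    from m + x and m + 1 - x up to m + 1. *)
Lemma gjet_prod_ge (x : R) m : 0 <= x < 1 -> (0 < m)%N ->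
  m%:R / m.+1%:R * m`!%:R ^+ 2 <= G (m.+1%:R + x) * G (m.+1%:R - x).
Proof.
move=> /andP[x0 x1]; case: m => // m _; set r : R := m.+1%:R.
have r0 : 0 < r by rewrite ltr0n.
have rM : m.+2%:R = r + 1 by rewrite natr1.
have rM0 : 0 < r + 1 by lra.
have rx0 : 0 < r + x by lra.
have Mx0 : 0 < r + 1 - x by lra.
have l1 : expR (x * ln (r + x)) * G (r + 1) <= G (r + 1 + x).
  have h : G (r + x + (1 - x)) <= expR ((1 - x) * ln (r + x)) * G (r + x).
    by apply: gjet_le => //; lra.
  have -> : r + 1 + x = (r + x) + 1 by ring.
  rewrite [leRHS]gjetD1 // [in leLHS](_ : r + 1 = r + x + (1 - x)); last by ring.
  apply: le_trans (ler_wpM2l (expR_ge0 _) h) _; rewrite mulrA -expRD -mulrDl.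
  by rewrite addrCA subrr addr0 mul1r lnK ?posrE.
have l2 : expR (- (x * ln (r + 1 - x))) * G (r + 1) <= G (r + 1 - x).
  have h : G (r + 1 - x + x) <= expR (x * ln (r + 1 - x)) * G (r + 1 - x).
    by apply: gjet_le => //; lra.
  rewrite subrK in h; apply: le_trans (ler_wpM2l (expR_ge0 _) h) _.
  by rewrite mulrA -expRD addNr expR0 mul1r.
rewrite rM (le_trans _ (ler_pM _ _ l1 l2)) ?mulr_ge0 ?expR_ge0 ?gjet_ge0 // {l1 l2}.
rewrite -rM gjet_fact [leRHS]mulrACA -expRD -expr2 ler_wpM2r ?sqr_ge0 // rM.
have -> : x * ln (r + x) - x * ln (r + 1 - x) = - (x * (ln (r + 1 - x) - ln (r + x))) by ring.
rewrite expRN -[leLHS]invf_div lef_pV2 ?posrE ?expR_gt0 ?divr_gt0 //.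
apply: le_trans (expR_convex _ _) _; first by apply/andP; split; lra.
rewrite expRD expRN !lnK ?posrE //.
have : (r + 1 - x) / (r + x) <= (r + 1) / r.
  by rewrite ler_pdivrMr // mulrAC ler_pdivlMr //; nra.
have : 1 <= (r + 1) / r by rewrite ler_pdivlMr // mul1r lerDl.
by move: ((r + 1) / r) ((r + 1 - x) / (r + x)) => w w' w1 w2; nra.
Qed.

(** Euler's reflection formula.  The product of k^2 - x^2 over k <= m relates
    Gamma(1 + x) Gamma(1 - x) to Gamma(m + 1 + x) Gamma(m + 1 - x), and
    sin(pi x) to the integral [wallis x m].  By the preceding bounds both are
    asymptotic to their values at x = 0, which confines the quotient c of the
    two sides between (m / (m + 1))^2 and (m + 1) / m for every m. *)
Lemma gjet_reflection (x : R) : 0 < x < 1 ->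
  G (1 + x) * G (1 - x) * sin (pi * x) = pi * x.
Proof.
move=> /andP[x0 x1]; have xn0 := lt0r_neq0 x0.
pose P m : R := \prod_(k < m) (k.+1%:R ^+ 2 - x ^+ 2).
have E m : wallis x m * P m * (pi / 2) = m`!%:R ^+ 2 * wallis 0 m * wallis x 0.
  elim: m => [|m IH]; first by rewrite /P big_ord0 fact0 wallis00; ring.
  rewrite /P big_ord_recr /= -/(P m).
  have Ex := wallisS x m.
  have E0 : m.+1%:R ^+ 2 * wallis 0 m.+1 = m.+1%:R * (m.*2.+1%:R / 2) * wallis 0 m :> R.
    by rewrite -wallisS; ring.
  transitivity ((m.+1%:R ^+ 2 - x ^+ 2) * wallis x m.+1 * P m * (pi / 2)); first ring.
  rewrite Ex; transitivity (m.+1%:R * (m.*2.+1%:R / 2) * (wallis x m * P m * (pi / 2))).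
    ring.
  rewrite IH factS natrM.
  transitivity (m`!%:R ^+ 2 * (m.+1%:R ^+ 2 * wallis 0 m.+1) * wallis x 0); last ring.
  by rewrite E0; ring.
set N := G (1 + x) * G (1 - x); pose c := N * (sin (pi * x) / (pi * x)).
have pi0 := pi_gt0 R; have pin0 := lt0r_neq0 pi0.
have bounds m : (0 < m)%N ->
    (m%:R / m.+1%:R) ^+ 2 <= c <= m.+1%:R / m%:R.
  move=> m0; have w0 := wallis_gt0 R m.
  have x01 : 0 <= x <= 1 by rewrite !ltW.
  have x01' : 0 <= x < 1 by rewrite ltW.
  have xN1 : -1 < x < 1 by apply/andP; split; lra.
  have hi := gjet_prod_le x01 m0; have lo := gjet_prod_ge x01' m0.
  rewrite gjet_prod // -/N -/(P m) in hi lo.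
  have wx : wallis x m <= wallis 0 m := wallis_le x m.
  have xw : m%:R / m.+1%:R * wallis 0 m <= wallis x m.
    by apply: wallis_ge; rewrite !ltW.
  have f0 : 0 < m`!%:R ^+ 2 :> R by rewrite exprn_gt0 // ltr0n fact_gt0.
  have cE : c * (m`!%:R ^+ 2 * wallis 0 m) = N * P m * wallis x m.
    have -> : c = N * wallis x 0 / (pi / 2).
      rewrite /c wallis0 //; move: (sin _) pin0 => s; move: (@pi R) => p pn.
      by field; rewrite xn0 pn.
    transitivity (N * (m`!%:R ^+ 2 * wallis 0 m * wallis x 0) / (pi / 2)); first ring.
    by rewrite -E; move: pin0; move: (@pi R) => p pn; field; rewrite pn.
  have fw0 : 0 < m`!%:R ^+ 2 * wallis 0 m :> R by rewrite mulr_gt0.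
  have m0' : 0 < m%:R :> R by rewrite ltr0n.
  apply/andP; split; rewrite -(ler_pM2r fw0) cE.
    have -> : (m%:R / m.+1%:R) ^+ 2 * (m`!%:R ^+ 2 * wallis 0 m) =
        (m%:R / m.+1%:R * m`!%:R ^+ 2) * (m%:R / m.+1%:R * wallis 0 m) :> R by ring.
    by apply: ler_pM => //; rewrite !mulr_ge0 ?divr_ge0 // ltW.
  rewrite mulrA; apply: ler_pM => //.
    by apply: le_trans lo; rewrite mulr_ge0 ?divr_ge0 // ltW.
  by apply: le_trans xw; rewrite mulr_ge0 ?divr_ge0 // ltW.
have c1 : c = 1.
  apply/eqP; rewrite -subr_eq0 -normr_le0; apply/ler_addgt0Pl => e e0; rewrite addr0.
  pose m := (Num.truncn (2 / e)).+1.
  have me : 2 / e < m%:R by exact: truncnS_gt.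
  have m0 : 0 < m%:R :> R by rewrite ltr0n.
  have m2 : 2 / m%:R <= e by rewrite ler_pdivrMr // mulrC -ler_pdivrMr // ltW.
  have /andP[lo hi] := bounds m isT.
  apply: le_trans m2; rewrite ler_norml; apply/andP; split.
    rewrite lerBrDr addrC; apply: le_trans lo.
    have -> : m%:R / m.+1%:R = 1 - m.+1%:R^-1 :> R.
      by rewrite -natr1; field; rewrite natr1 pnatr_eq0.
    have : m.+1%:R^-1 <= m%:R^-1 :> R by rewrite lef_pV2 ?posrE ?ler_nat.
    by move: (m.+1%:R^-1) (m%:R^-1) => a b ab; have := sqr_ge0 a; nra.
  rewrite lerBlDr; apply: le_trans hi _.
  rewrite ler_pdivrMr // mulrDl divfK ?lt0r_neq0 // mul1r -natr1.
  by rewrite addrC lerD2r ler1n.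
have px0 : pi * x != 0 by rewrite mulf_neq0 // lt0r_neq0.
by move: c1; rewrite /c mulrA => /(canRL (divfK px0)); rewrite mul1r.
Qed.

End Reflection.

(** * Sequences of successive derivatives *)

Section Jets.
Variable R : realType.
Implicit Types (U : set R) (F G : nat -> R -> R).

(** Smoothness presented by the whole sequence of derivatives: formulas for all
    the derivatives at once are then proved by a single differentiation, without
    iterating the derivative operator. *)
Definition jet U F := forall n (x : R), U x -> is_derive x 1 (F n) (F n.+1 x).

Lemma jet_derive1n U F (f : R -> R) : open U -> jet U F ->
  (forall x, U x -> f x = F 0%N x) -> forall n x, U x -> derive1n n f x = F n x.
Proof.
move=> oU jF fF; elim=> [|n IH] x Ux; first exact: fF.
rewrite derive1nS derive1E (@near_eq_derive _ _ _ _ (F n)) ?oner_eq0 //.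
  have d := jF n x Ux; exact: derive_val.
by near=> y; apply: IH; near: y; exact: open_nbhs_nbhs.
Unshelve. all: by end_near. Qed.

Lemma jet_unique U F G : open U -> jet U F -> jet U G ->
  (forall x, U x -> F 0%N x = G 0%N x) -> forall n x, U x -> F n x = G n x.
Proof.
move=> oU jF jG FG n x Ux.
rewrite -(jet_derive1n oU jF (fun y _ => erefl)) //.
by apply: (jet_derive1n oU jG).
Qed.

Definition jet_mul F G n (x : R) := \sum_(k < n.+1) 'C(n, k)%:R * (F k x * G (n - k)%N x).

(** Leibniz's rule; the induction step is Pascal's rule. *)
Lemma jet_mulP U F G : jet U F -> jet U G -> jet U (jet_mul F G).
Proof.
move=> jF jG n x Ux.
have d (k : 'I_n.+1) : is_derive x 1 (fun y => 'C(n, k)%:R * (F k y * G (n - k)%N y))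
    ('C(n, k)%:R * (F k x * G (n.+1 - k)%N x + F k.+1 x * G (n - k)%N x)).
  have dM := is_deriveM (jF k x Ux) (jG (n - k)%N x Ux).
  apply: (is_derive_eq (is_deriveZ 'C(n, k)%:R dM)).
  have kn : (k <= n)%N by rewrite -ltnS ltn_ord.
  rewrite (subSn kn) -![_ *: _]/(_ * _); congr (_ * (_ + _)).
  exact: mulrC.
have -> : jet_mul F G n = \sum_(k < n.+1) (fun y => 'C(n, k)%:R * (F k y * G (n - k)%N y)).
  by apply/funext => y; rewrite fct_sumE.
apply: (is_derive_eq (is_derive_sum d)).
rewrite /jet_mul; under eq_bigr do rewrite mulrDr.
rewrite big_split /= [RHS]big_ord_recl bin0 mul1r subn0.
rewrite [X in X + _]big_ord_recl [X in _ + X]big_ord_recr /= bin0 mul1r subn0 binn mul1r subnn.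
rewrite [in RHS]big_ord_recr /= /bump /= binn mul1r subnn.
rewrite -[LHS]addrA; congr (_ + _).
rewrite addrA; congr (_ + _).
rewrite -big_split /=; apply: eq_bigr => k _.
by rewrite /bump /= !add1n binS natrD mulrDl !subSS addrC.
Qed.

Lemma jet_comp_affine U F (a b : R) : jet U F ->
  jet (fun x => U (a * x + b)) (fun n x => a ^+ n * F n (a * x + b)).
Proof.
move=> jF n x Ux.
have dg : is_derive x 1 (fun y : R => a * y + b) a.
  have -> : (fun y : R => a * y + b) = a *: id + cst b by [].
  by apply: is_derive_eq; rewrite addr0 [LHS]mulr1.
have dF := @is_derive1_comp _ (F n) _ x _ _ (jF n _ Ux) dg.
apply: (is_derive_eq (is_deriveZ (a ^+ n) dF)).
by rewrite exprSr -[_ *: _]/(_ * _); ring.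
Qed.

Lemma jetW U V F : V `<=` U -> jet U F -> jet V F.
Proof. by move=> VU jF n x /VU; exact: jF. Qed.

Lemma jet_horner (p : {poly R}) : jet setT (fun n => horner p^`(n)).
Proof. by move=> n x _; rewrite derivnS; exact: is_derive_poly. Qed.

Lemma jet_sin (b : R) : jet setT (fun n x => sin (x + b + n%:R * (pi / 2))).
Proof.
move=> n x _.
have dg : is_derive x 1 (fun y : R => y + (b + n%:R * (pi / 2))) 1.
  have -> : (fun y : R => y + (b + n%:R * (pi / 2))) = id + cst (b + n%:R * (pi / 2)) by [].
  by apply: is_derive_eq; rewrite addr0.
have ds := @is_derive1_comp _ sin _ x _ _ (is_derive_sin _) dg.
have -> : (fun y : R => sin (y + b + n%:R * (pi / 2))) =
    sin \o (fun y : R => y + (b + n%:R * (pi / 2))).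
  by apply/funext => y /=; rewrite addrA.
apply: (is_derive_eq ds).
by rewrite mulr1 -sinDpihalf -natr1; congr sin; ring.
Qed.

End Jets.

(** * Derivatives of the reflection formula *)

Definition quarter_sin (j : nat) : int := if odd j then (-1) ^+ j./2 else 0.

Lemma sin_quarter (R : realType) j : sin (j%:R * (pi / 2)) = (quarter_sin j)%:~R :> R.
Proof.
have [n] := ubnP j; elim: n j => // n IH [|[|j]] jn.
- by rewrite mul0r sin0.
- by rewrite mul1r sin_pihalf.
have -> : j.+2%:R * (pi / 2) = j%:R * (pi / 2) + pi :> R.
  by rewrite -!natr1; move: (@pi R) => p; field.
rewrite sinDpi IH; last by rewrite ltnW.
by rewrite /quarter_sin /= negbK; case: ifP => _; rewrite ?oppr0 // exprS mulN1r rmorphN.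
Qed.

Lemma quarter_sin_unit j : odd j -> `|quarter_sin j|%N = 1%N.
Proof. by rewrite /quarter_sin => ->; rewrite abszX exp1n. Qed.

Section ReflectionCoefficients.
Variables (R : realType) (e : bool).
Local Notation c := (~~ e : nat).

(** The two points to which the half-integers reduce modulo 1.  They are the
    centres about which the reflection formula is symmetric:
    Gamma(1/2 + x) Gamma(1/2 - x) cos(pi x) = pi and
    Gamma(1 + x) Gamma(1 - x) sin(pi x) = pi x.  Reading cos as a sine shifted
    by e = 1 quarter turns, and x^0 or x^1 as x^c with c = 1 - e, makes these a
    single formula. *)
Definition base : R := if e then 2^-1 else 1.

(** The n-th derivative at x = 0 of Gamma(base + x) Gamma(base - x), expanded by
    Leibniz's rule. *)
Definition refl_coeff n : R :=
  \sum_(k < n.+1) 'C(n, k)%:R * (gjet k base * ((-1) ^+ (n - k) * gjet (n - k) base)).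

Let h (x : R) := gjet 0 (base + x) * gjet 0 (base - x).

Let h_sin (x : R) : - 2^-1 < x < 2^-1 ->
  h x * sin (pi * x + e%:R * (pi / 2)) = pi * x ^+ c.
Proof.
rewrite /h /base; case: e => /= /andP[x0 x1].
  have y01 : 0 < 2^-1 + x < 1 by apply/andP; split; lra.
  have := gjet_reflection y01; rewrite addrC gjetD1; last by lra.
  have -> : 1 - (2^-1 + x) = 2^-1 - x by field.
  have -> : pi * (2^-1 + x) = pi * x + 1 * (pi / 2) by rewrite mulrDr mul1r addrC.
  have y0 : 2^-1 + x != 0 by rewrite lt0r_neq0 //; lra.
  move=> E; rewrite expr0 mulr1; apply: (mulfI y0).
  transitivity (pi * x + 1 * (pi / 2) : R); last by move: (@pi R) => p; field.
  by rewrite -[RHS]E !mulrA.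
rewrite mul0r addr0 expr1.
have pos (y : R) : 0 < y < 2^-1 -> gjet 0 (1 + y) * gjet 0 (1 - y) * sin (pi * y) = pi * y.
  by move=> /andP[y0 y1]; apply: gjet_reflection; apply/andP; split; lra.
have [xn|xp|->] := ltgtP x 0; last by rewrite !mulr0 sin0 mulr0.
  have xN : 0 < - x < 2^-1 by apply/andP; split; lra.
  have := pos _ xN; rewrite opprK mulrN sinN !mulrN => /oppr_inj E.
  by rewrite -[RHS]E [X in X * _]mulrC.
by apply: pos; apply/andP; split; lra.
Qed.

(** The n-th derivative at x = 0 of the reflection formula
    Gamma(base + x) Gamma(base - x) sin(pi x + e pi / 2) = pi x^c. *)
Lemma refl_coeff_recursion n :
  \sum_(k < n.+1) 'C(n, k)%:R *
    (refl_coeff k * (pi ^+ (n - k) * (quarter_sin (n - k + e))%:~R)) =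
  pi * (n == c)%:R.
Proof.
pose U : set R := `]- 2^-1, 2^-1[%classic.
have oU : open U by exact: interval_open.
have U0 : U 0 by rewrite /U /= in_itv /=; apply/andP; split; lra.
have base_ge : 2^-1 <= base by rewrite /base; case: e; lra.
have jG : jet [set x : R | 0 < x] (@gjet R) by move=> k x; exact: is_derive_gjet.
pose F1 k x := 1 ^+ k * gjet k (1 * x + base).
pose F2 k x := (-1) ^+ k * gjet k (-1 * x + base).
have jF1 : jet U F1.
  have j := @jet_comp_affine R _ _ 1 base jG.
  apply: jetW j => x; rewrite /U /= in_itv /= => /andP[x0 x1]; lra.
have jF2 : jet U F2.
  have j := @jet_comp_affine R _ _ (-1) base jG.
  apply: jetW j => x; rewrite /U /= in_itv /= => /andP[x0 x1]; lra.
pose S k x := pi ^+ k * sin (pi * x + 0 + e%:R * (pi / 2) + k%:R * (pi / 2)) : R.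
have jS : jet U S.
  have j := @jet_comp_affine R _ _ pi 0 (@jet_sin R (e%:R * (pi / 2))).
  by apply: jetW j => x _.
have F1E k : F1 k 0 = gjet k base by rewrite /F1 expr1n mul1r mulr0 add0r.
have F2E k : F2 k 0 = (-1) ^+ k * gjet k base by rewrite /F2 mulr0 add0r.
have SE k : S k 0 = pi ^+ k * (quarter_sin (k + e))%:~R.
  by rewrite /S mulr0 !add0r -mulrDl -natrD addnC sin_quarter.
pose p : {poly R} := pi *: 'X^c.
have jP : jet U (fun n => horner p^`(n)) by apply: jetW (@jet_horner R p).
have jH := jet_mulP jF1 jF2.
have := jet_unique oU (jet_mulP jH jS) jP _ n U0.
rewrite horner_coef0 coef_derivn addn0 ffactnn coefZ coefXn.
have -> : (pi * (n == c)%:R) *+ n`! = pi * (n == c)%:R :> R.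
  by case: eqVneq => [->|_]; [case: e|rewrite mulr0 mul0rn].
move=> <-.
  rewrite /jet_mul /refl_coeff; apply: eq_bigr => k _; rewrite SE.
  by under [in RHS]eq_bigr do rewrite F1E F2E.
move=> x Ux; rewrite /jet_mul !big_ord1 /= !bin0 !mul1r !subnn /S /F1 /F2 !expr0 !mul1r.
rewrite ?derivn0 hornerZ hornerXn mulN1r mul0r !addr0.
rewrite -h_sin; first by rewrite /h ![_ + base]addrC.
by move: Ux; rewrite /U /= in_itv.
Qed.

End ReflectionCoefficients.

(** * Rationality and non-vanishing of the coefficients *)

Section RationalCoefficients.
Variable e : bool.
Local Notation c := (~~ e : nat).

(** For c = 1 the recursion of order n + 1 does not involve the coefficient of
    order n + 1, which is multiplied by sin 0; the recursion of order n + c thus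
    determines the n-th coefficient for both values of c. *)
Lemma refl_coeff_recursion_trimmed (R : realType) n :
  \sum_(k < n.+1) 'C(n + c, k)%:R *
    (refl_coeff R e k * (pi ^+ (n + c - k) * (quarter_sin (n - k).+1)%:~R)) =
  pi * (n == 0%N)%:R :> R.
Proof.
have := refl_coeff_recursion R e (n + c); rewrite -[X in (_ == X)%:R]add0n eqn_add2r => <-.
transitivity (\sum_(k < n.+1) 'C(n + c, k)%:R *
    (refl_coeff R e k * (pi ^+ (n + c - k) * (quarter_sin (n + c - k + e))%:~R)) : R).
  apply: eq_bigr => -[k /=]; rewrite ltnS => kn _.
  by rewrite -addnBAC // -addnA; case: e; rewrite ?addn1 //= addn0 addn1.
case: e => /=; first by rewrite addn0.
rewrite addn1 [RHS]big_ord_recr /= subnn addn0.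
by rewrite /quarter_sin /= !mulr0 addr0.
Qed.

(** The recursion left after division by the powers of pi: the r n are, up to
    the factor n!, the power series coefficients of x^c / sin(x + e pi / 2). *)
Definition rational_reciprocal (r : nat -> rat) := forall n,
  \sum_(k < n.+1) 'C(n + c, k)%:R * (r k * (quarter_sin (n - k).+1)%:~R) =
  (n == 0%N)%:R.

(** The recursion is homogeneous: if pi has weight 1 and the k-th coefficient has
    weight k + e, every term of the recursion of order n + c has weight n + 1.
    Solving it successively thus yields rational multiples of powers of pi. *)
Lemma refl_coeff_rational (R : realType) : exists r : nat -> rat,
  (forall n, refl_coeff R e n = pi ^+ (n + e) * ratr (r n)) /\ rational_reciprocal r.
Proof.
have pin0 : (pi : R) != 0 by rewrite lt0r_neq0 // pi_gt0.
have step n (f : nat -> rat) m : (m <= n.+1)%N ->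
    (forall k, (k < m)%N -> refl_coeff R e k = pi ^+ (k + e) * ratr (f k)) ->
    \sum_(k < m) 'C(n + c, k)%:R *
      (refl_coeff R e k * (pi ^+ (n + c - k) * (quarter_sin (n - k).+1)%:~R)) =
    pi ^+ n.+1 * ratr (\sum_(k < m) 'C(n + c, k)%:R * (f k * (quarter_sin (n - k).+1)%:~R)).
  move=> mn fE; rewrite rmorph_sum mulr_sumr; apply: eq_bigr => -[k km] _ /=.
  rewrite fE // !rmorphM /= !rmorph_nat ratr_int.
  have -> : pi ^+ n.+1 = pi ^+ (k + e) * pi ^+ (n + c - k) :> R.
    rewrite -exprD; congr (_ ^+ _); have := leq_trans km mn; case: e; rewrite /=; lia.
  ring.
have delta n : pi * (n == 0%N)%:R = pi ^+ n.+1 * ratr (n == 0%N)%:R :> R.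
  by rewrite rmorph_nat; case: eqVneq => [->|_]; rewrite ?expr1 // !mulr0.
have ex n : exists f : nat -> rat, forall k, (k < n)%N ->
    refl_coeff R e k = pi ^+ (k + e) * ratr (f k).
  elim: n => [|n [f fE]]; first by exists (fun=> 0).
  pose s := \sum_(k < n) 'C(n + c, k)%:R * (f k * (quarter_sin (n - k).+1)%:~R).
  exists (fun k => if k == n then ((n == 0%N)%:R - s) / 'C(n + c, n)%:R else f k).
  move=> k; rewrite ltnS leq_eqVlt => /orP[/eqP->|kn]; last by rewrite ltn_eqF // fE.
  rewrite eqxx; have := refl_coeff_recursion_trimmed R n.
  rewrite big_ord_recr /= (step n f n) // delta -/s subnn (_ : quarter_sin 1 = 1) // mulr1.
  have C0 : 'C(n + c, n)%:R != 0 :> R by rewrite pnatr_eq0 -lt0n bin_gt0 leq_addr.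
  have pc : pi ^+ (n + c - n) != 0 :> R by rewrite expf_neq0.
  move=> /(canRL (addKr _)); rewrite addrC -mulrBr -rmorphB => E.
  apply: (mulfI C0); apply: (mulIf pc); rewrite -mulrA E.
  rewrite fmorph_div rmorph_nat.
  have -> : pi ^+ n.+1 = pi ^+ (n + e) * pi ^+ (n + c - n) :> R.
    by rewrite -exprD; congr (_ ^+ _); case: e; rewrite /=; lia.
  by field.
have /choice[r rE] : forall n, exists x : rat, refl_coeff R e n = pi ^+ (n + e) * ratr x.
  by move=> n; have [f fE] := ex n.+1; exists (f n); apply: fE.
exists r; split=> // n; have := refl_coeff_recursion_trimmed R n.
rewrite (step n r n.+1) // delta => /(mulfI (expf_neq0 n.+1 pin0)).
exact: fmorph_inj.
Qed.

Lemma common_denominator (x : nat -> rat) M : exists (d : int) (a : nat -> int),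
  (0 < d) /\ forall k, (k < M)%N -> d%:~R * x k = (a k)%:~R.
Proof.
elim: M => [|M [d [a [d0 da]]]]; first by exists 1, (fun=> 0).
exists (d * denq (x M)), (fun k => if k == M then d * numq (x M) else a k * denq (x M)).
split; first by rewrite mulr_gt0 ?denq_gt0.
move=> k; rewrite ltnS leq_eqVlt => /orP[/eqP->|kM].
  by rewrite eqxx !intrM numqE; ring.
by rewrite ltn_eqF // !intrM -da //; ring.
Qed.

(** Suppose that r n = 0 from M on, let d be a common denominator of the
    r k / k! and let n be even.  Multiplied by d, the recursion with N = n + c
    becomes an integral relation whose term k = 0 is d or -d and whose
    other terms contain a falling factorial of N, a multiple of N; hence N
    divides d, which is false for large n. *)
Lemma rational_reciprocal_neq0 r : rational_reciprocal r ->
  forall M, exists2 n, (M <= n)%N & r n != 0.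
Proof.
move=> rr M; apply: contrapT => no.
have r_eq0 n : (M <= n)%N -> r n = 0.
  by move=> Mn; apply/eqP/negP => /negP rn; apply: no; exists n.
have r0 : r 0%N = 1.
  by have := rr 0%N; rewrite big_ord1 bin0 mul1r (_ : quarter_sin _ = 1) // mulr1z mulr1.
have M0 : (0 < M)%N.
  rewrite lt0n; apply/eqP => M0; move: (r_eq0 0%N).
  by rewrite M0 r0 => /(_ isT)/eqP; rewrite oner_eq0.
have [d [a [d0 da]]] := common_denominator (fun k => r k / k`!%:R) M.
pose n := (`|d| + M).*2; pose N := (n + c)%N.
have n0 : (n == 0%N) = false by rewrite /n; lia.
have Mn : (M <= n)%N by rewrite /n; lia.
have : \sum_(k < M) (N ^_ k)%:R * (a k * quarter_sin (n - k).+1) = 0.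
  apply: (@intr_inj rat); rewrite rmorph_sum /=.
  have /(congr1 (fun x => d%:~R * x)) := rr n; rewrite n0 mulr0 mulr_sumr => E.
  pose F k : rat := ((N ^_ k)%:R * (a k * quarter_sin (n - k).+1))%:~R.
  rewrite -[RHS]E (big_ord_widen n.+1 F) /F; last by rewrite ltnW.
  rewrite big_mkcond; apply: eq_bigr => -[k kn] _ /=; case: ltnP => kM; last first.
    by rewrite r_eq0 // mul0r !mulr0.
  rewrite !intrM -da // (rmorph_nat intr) -bin_ffact natrM.
  have : k`!%:R != 0 :> rat by rewrite pnatr_eq0 -lt0n fact_gt0.
  by move: (k`!%:R) => f f0; field.
rewrite -(prednK M0) big_ord_recl /= ffactn0 mul1r subn0.
have -> : a 0%N = d by apply: (@intr_inj rat); rewrite -da //= r0 fact0 divr1.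
move/eqP; rewrite addr_eq0 => /eqP E.
have : (N%:Z %| d * quarter_sin n.+1)%Z.
  rewrite E -sumrN; apply: rpred_sum => k _; rewrite rpredN.
  by rewrite /bump /= add1n ffactnS natrM -mulrA dvdz_mulr // natz.
rewrite dvdzE abszM quarter_sin_unit ?muln1 /=; last by rewrite /n odd_double.
move=> /dvdn_leq; rewrite absz_gt0 gt_eqF // => /(_ isT).
rewrite /N /n; lia.
Qed.

End RationalCoefficients.

(** * Spans over the field of real algebraic numbers *)

Section AlgebraicReals.
Variable R : realType.
Local Notation algebraic := (algebraicOver (ratr : rat -> R)).

Definition algebraic_pred : {pred R} := fun x => `[< algebraic x >].

Lemma algebraic_predP x : reflect (algebraic x) (x \in algebraic_pred).
Proof. exact: asboolP. Qed.

Fact algebraic_divring_closed : divring_closed algebraic_pred.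
Proof.
split=> [|x y /algebraic_predP ax /algebraic_predP ay|x y /algebraic_predP ax /algebraic_predP ay].
- by apply/algebraic_predP; exact: algebraic1.
- by apply/algebraic_predP; exact: algebraic_sub.
- by apply/algebraic_predP; exact: algebraic_div.
Qed.
HB.instance Definition _ := GRing.isDivringClosed.Build R algebraic_pred algebraic_divring_closed.

(** Packaged as a type so that the rank theory of matrices over a field applies. *)
Record algreal := AlgReal { algval :> R; _ : algval \in algebraic_pred }.
HB.instance Definition _ := [isSub for algval].
HB.instance Definition _ := [Choice of algreal by <:].
HB.instance Definition _ := [SubChoice_isSubComUnitRing of algreal by <:].
HB.instance Definition _ := [SubComUnitRing_isSubIntegralDomain of algreal by <:].
HB.instance Definition _ := [SubIntegralDomain_isSubField of algreal by <:].

Let valR : {rmorphism algreal -> R} := val.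
Let val0 : algval 0 = 0. Proof. exact: (rmorph0 valR). Qed.
Let valM a b : algval (a * b) = algval a * algval b. Proof. exact: (rmorphM valR). Qed.
Let val_sum n (F : 'I_n -> algreal) : algval (\sum_i F i) = \sum_i algval (F i).
Proof. exact: (rmorph_sum valR). Qed.
Let val_eq0 a : (algval a == 0) = (a == 0). Proof. exact: (fmorph_eq0 valR). Qed.

Definition aspan (I : finType) (w : I -> R) (x : R) :=
  exists a : I -> algreal, x = \sum_i algval (a i) * w i.

Lemma aspan0 (I : finType) (w : I -> R) : aspan w 0.
Proof.
by exists (fun=> 0); rewrite big1 // => i _; rewrite val0 mul0r.
Qed.

Lemma aspanD (I : finType) (w : I -> R) x y : aspan w x -> aspan w y -> aspan w (x + y).
Proof.
move=> [a ->] [b ->]; exists (fun i => a i + b i); rewrite -big_split /=.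
by apply: eq_bigr => i _ /=; rewrite mulrDl.
Qed.

Lemma aspanZ (I : finType) (w : I -> R) c x : algebraic c -> aspan w x -> aspan w (c * x).
Proof.
move=> /algebraic_predP ac [a ->]; exists (fun i => AlgReal ac * a i); rewrite mulr_sumr.
by apply: eq_bigr => i _ /=; rewrite mulrA.
Qed.

Lemma aspan_sum (I : finType) (w : I -> R) n (F : 'I_n -> R) :
  (forall k, aspan w (F k)) -> aspan w (\sum_k F k).
Proof. by move=> wF; apply: big_ind => //; [exact: aspan0|exact: aspanD]. Qed.

Lemma aspanM (I J : finType) (w : I -> R) (u : J -> R) x y :
  aspan w x -> aspan u y -> aspan (fun p : I * J => w p.1 * u p.2) (x * y).
Proof.
move=> [a ->] [b ->]; exists (fun p => a p.1 * b p.2).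
rewrite mulr_suml -(pair_bigA _ (fun i j => algval (a i * b j) * (w i * u j))) /=.
apply: eq_bigr => i _; rewrite mulr_sumr; apply: eq_bigr => j _.
by rewrite /= mulrACA.
Qed.

(** More vectors than generators are dependent: the matrix of coefficients has
    more rows than columns, hence a nonzero vector in its left kernel. *)
Lemma aspan_dependence (I : finType) (w : I -> R) (y : 'I_#|I|.+1 -> R) :
  (forall i, aspan w (y i)) -> exists l : 'I_#|I|.+1 -> algreal,
    (exists i, l i != 0) /\ \sum_i algval (l i) * y i = 0.
Proof.
move=> /choice[a aE].
pose M : 'M[algreal]_(#|I|.+1, #|I|) := \matrix_(i, j) a i (enum_val j).
have kn0 : kermx M != 0.
  rewrite -mxrank_eq0 mxrank_ker subn_eq0 -ltnNge ltnS; exact: rank_leq_col.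
pose v := nz_row (kermx M).
have v0 : v != 0 by rewrite nz_row_eq0.
have vM : v *m M = 0 by apply/sub_kermxP; exact: nz_row_sub.
exists (v 0); split; first exact/rV0Pn.
transitivity (\sum_i \sum_j algval (v 0 j) * (algval (a j i) * w i)).
  rewrite exchange_big; apply: eq_bigr => i _ /=.
  by rewrite aE mulr_sumr.
apply: big1 => i _; have := congr1 (fun N : 'rV_#|I| => N 0 (enum_rank i)) vM.
rewrite !mxE => /(congr1 algval).
rewrite val_sum val0.
move=> /(congr1 (fun z => z * w i)); rewrite mul0r mulr_suml => {2}<-.
apply: eq_bigr => j _; rewrite mxE enum_rankK.
by rewrite valM mulrA.
Qed.

(** A linear dependence between distinct powers of x is a polynomial equation
    for x with algebraic coefficients, so x is algebraic. *)
Lemma aspan_powers_algebraic (I : finType) (w : I -> R) (x : R) :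
  (forall M, exists2 m, (M <= m)%N & aspan w (x ^+ m)) -> algebraic x.
Proof.
move=> /(_ _)/cid2 xw; pose f M := projT1 (xw M).
pose m := fix m k := if k is k'.+1 then f (m k').+1 else f 0%N.
have fP M : (M <= f M)%N /\ aspan w (x ^+ f M) by rewrite /f; case: (xw M).
have m_incr k : (m k < m k.+1)%N by have [] := fP (m k).+1.
have m_span k : aspan w (x ^+ m k) by case: k => [|k]; [case: (fP 0%N)|case: (fP (m k).+1)].
have m_inj : injective m.
  have mono : {homo m : i j / (i < j)%N}.
    by apply: homo_ltn m_incr => a b c; exact: ltn_trans.
  move=> i j; case: (ltngtP i j) => // /mono lt E; by rewrite E ltnn in lt.
have [l [[i0 l0] lE]] := aspan_dependence (fun i : 'I_#|I|.+1 => m_span i).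
pose p : {poly R} := \sum_i algval (l i) *: 'X^(m i).
have pm (i : 'I_#|I|.+1) : p`_(m i) = algval (l i).
  rewrite coef_sum (bigD1 i) //= coefZ coefXn eqxx mulr1 big1 ?addr0 // => j ji.
  rewrite coefZ coefXn; case: eqP => [/m_inj/val_inj E|_]; last by rewrite mulr0.
  by rewrite E eqxx in ji.
have p0 : p != 0.
  apply/eqP => p0; have := pm i0; rewrite p0 coef0 => /esym/eqP.
  by rewrite val_eq0 (negbTE l0).
have px : root p x.
  apply/eqP; rewrite horner_sum -[RHS]lE; apply: eq_bigr => i _.
  by rewrite hornerZ hornerXn.
apply/integral_algebraic; apply: (integral_root p0 px).
apply/integral_poly => k; apply/integral_algebraic/algebraic_predP.
rewrite coef_sum; apply: rpred_sum => i _; rewrite coefZ coefXn.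
by rewrite rpredM ?rpred_nat //; case: (l i).
Qed.

End AlgebraicReals.

(** * Derivatives of Gamma away from the poles *)

Section GammaJets.
Variable R : realType.
Local Notation algebraic := (algebraicOver (ratr : rat -> R)).
Local Notation gamma n q := (derive1n n (@Gamma R) q).

Lemma Gamma_gjet (x : R) : 0 < x -> Gamma x = gjet 0 x.
Proof.
move=> x0; rewrite Gamma_gt0E //; apply: eq_Rintegral => t /[!inE] /=.
by rewrite in_itv /= andbT => t0; rewrite /gker expr0 mulr1 /powR gt_eqF.
Qed.

Lemma GammaD1 (x : R) : x != 0 -> Gamma (x + 1) = x * Gamma x.
Proof.
move=> xn0; have [x0|x0] := leP x 0; first by rewrite (Gamma_le0E x0) mulrC divfK.
by rewrite !Gamma_gjet ?gjetD1 // addr_gt0.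
Qed.

(** Not being a pole, in the form that the shifts q |-> q + m preserve. *)
Definition nonpole (q : R) := forall m : nat, q != - m%:R.

Lemma nonpole_neq0 q : nonpole q -> q != 0.
Proof. by move=> /(_ 0%N); rewrite oppr0. Qed.

Lemma nonpoleD q m : nonpole q -> nonpole (q + m%:R).
Proof.
move=> qn k; apply: contra (qn (k + m)%N) => /eqP E.
by rewrite natrD opprD -E addrK.
Qed.

(** A local presentation of Gamma as a smooth function; it allows Gamma, defined
    piecewise, to be differentiated to the left of 0. *)
Definition gamma_jet (U : set R) (F : nat -> R -> R) :=
  [/\ open U, jet U F & forall x, U x -> Gamma x = F 0%N x].

Lemma gamma_jetE U F q n : gamma_jet U F -> U q -> gamma n q = F n q.
Proof. by move=> [oU jF E] Uq; apply: (jet_derive1n oU jF E). Qed.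

Lemma gamma_jet_gt0 : gamma_jet [set x | 0 < x] (@gjet R).
Proof.
split; [exact: open_gt|by move=> n x; exact: is_derive_gjet|exact: Gamma_gjet].
Qed.

Let shift_open U : open U -> open [set x : R | U (x + 1)].
Proof.
by move=> oU; apply: open_comp oU => x _; apply: cvgD; [exact: cvg_id|exact: cvg_cst].
Qed.

Let shift_jet (U : set R) (F : nat -> R -> R) :
  jet U F -> jet [set x | U (x + 1)] (fun n x => F n (x + 1)).
Proof.
move=> jF n x Ux; have := @jet_comp_affine R U F 1 1 jF n x.
rewrite !mul1r !expr1n !mul1r => /(_ Ux).
by under eq_fun do rewrite mul1r mul1r.
Qed.

(** The derivatives f n of F(x + 1) / x, obtained by solving
    x f n x + n f n.-1 x = F n (x + 1), the n-th derivative of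
    x f(x) = F(x + 1), for f n x. *)
Fixpoint jet_down (F : nat -> R -> R) n (x : R) {struct n} : R :=
  if n is n'.+1 then (F n (x + 1) - n%:R * jet_down F n' x) / x
  else F 0%N (x + 1) / x.

Lemma gamma_jet_down U F : gamma_jet U F ->
  gamma_jet ([set x | x != 0] `&` [set x | U (x + 1)]) (jet_down F).
Proof.
move=> [oU jF E]; have jS := shift_jet jF; split.
- apply: openI; last exact: shift_open.
  exact: open_neq.
- move=> n x [/= x0 Ux].
  have dV := is_deriveV (x0 : id x != 0) (is_derive_id x 1).
  have dS n' := jS n' x Ux.
  elim: n => [|n IH].
    apply: (is_derive_eq (is_deriveM (dS 0%N) dV)).
    rewrite /= -![_ *: _]/(_ * _); field; exact: x0.
  apply: (is_derive_eq (is_deriveM (is_deriveB (dS n.+1) (is_deriveZ n.+1%:R IH)) dV)).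
  rewrite -![_ *: _]/(_ * _) -[n.+2%:R]natr1.
  rewrite [X in X * _ + _](_ : _ = F n.+1 (x + 1) - n.+1%:R * jet_down F n x) //=.
  move: (jet_down F n x) (F n.+1 (x + 1)) (F n.+2 (x + 1)) n.+1%:R => a b c d.
  by field.
- by move=> x [/= x0 Ux]; rewrite -(E _ Ux) GammaD1 // mulrC mulKf.
Qed.

(** Starting from the Euler integral on the positive half-line, unit steps to the
    left reach every point that is not a pole. *)
Lemma gamma_jet_nonpole q : nonpole q -> exists U F, gamma_jet U F /\ U q.
Proof.
suff key m : forall p : R, nonpole p -> 0 < p + m%:R ->
    exists U F, gamma_jet U F /\ U p.
  move=> qn; apply: (key (Num.truncn (- q)).+1) => //.
  by rewrite -ltrBlDl sub0r; exact: truncnS_gt.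
elim: m {q} => [|m IH] q qn qm.
  by exists [set x | 0 < x], (@gjet R); rewrite addr0 in qm; split=> //; exact: gamma_jet_gt0.
have [|U [F [jF Uq]]] := IH (q + 1) (nonpoleD 1%N qn).
  by rewrite -addrA [1 + _]addrC natr1.
exists ([set x | x != 0] `&` [set x | U (x + 1)]), (jet_down F).
by split; [exact: gamma_jet_down|split=> //=; exact: nonpole_neq0].
Qed.

(** The n-th derivative of Gamma(x + 1) = x Gamma(x); at n = 0 the second term
    disappears through its coefficient. *)
Lemma gamma_derivD1 q n : nonpole q ->
  gamma n (q + 1) = q * gamma n q + n%:R * gamma n.-1 q.
Proof.
move=> qn; have q0 := nonpole_neq0 qn.
have [U [F [jU Uq]]] := gamma_jet_nonpole qn.
have [V [H [jV Vq]]] := gamma_jet_nonpole (nonpoleD 1%N qn).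
rewrite !(gamma_jetE _ jU Uq) (gamma_jetE _ jV Vq).
case: jU jV => [oU jU EU] [oV jV EV].
pose W := [set x : R | x != 0] `&` (U `&` [set x | V (x + 1)]).
have oW : open W.
  by apply: openI; [exact: open_neq|apply: openI => //; exact: shift_open].
have jA : jet W (fun n x => H n (x + 1)).
  by apply: jetW (shift_jet jV) => x [_ []].
have jB : jet W (fun n x => x * F n x + n%:R * F n.-1 x).
  move=> k x [_ [Ux _]].
  have dx := is_deriveM (is_derive_id x 1) (jU k x Ux).
  apply: (is_derive_eq (is_deriveD dx (is_deriveZ k%:R (jU k.-1 x Ux)))).
  rewrite -![_ *: _]/(_ * _) /= mulr1 -natr1 mulrDl mul1r.
  case: k {dx} => [|k] /=; first by rewrite !mul0r addr0 add0r.
  by rewrite -addrA [F k.+1 x + _]addrC.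
apply: (jet_unique oW jA jB _ n (x := q)); last by split=> //.
by move=> x [/= x0 [Ux Vx]]; rewrite mul0r addr0 -(EV _ Vx) -(EU _ Ux) GammaD1.
Qed.

(** By [gamma_derivD1] the derivatives at q and at q + 1 are triangular
    combinations of each other, with coefficients in the field generated by q. *)
Lemma aspan_gammaD1 (I : finType) (w : I -> R) q : nonpole q -> algebraic q ->
  (forall n, aspan w (gamma n q)) <-> (forall n, aspan w (gamma n (q + 1))).
Proof.
have anat n : algebraic n%:R.
  by rewrite -(rmorph_nat (ratr : {rmorphism rat -> R})); exact: algebraic_id.
move=> qn aq; split=> wq n.
  by rewrite gamma_derivD1 //; apply: aspanD; apply: aspanZ.
have q0 := nonpole_neq0 qn.
have E k : gamma k q = q^-1 * (gamma k (q + 1) + - k%:R * gamma k.-1 q).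
  by rewrite gamma_derivD1 // mulNr addrK mulKf.
elim: n => [|n IH]; rewrite E; apply: aspanZ; try exact: algebraic_inv.
  by rewrite oppr0 mul0r addr0.
by apply: aspanD => //; apply: aspanZ => //; exact: algebraic_opp.
Qed.

Lemma aspan_gammaDn (I : finType) (w : I -> R) q m : nonpole q -> algebraic q ->
  (forall n, aspan w (gamma n q)) <-> (forall n, aspan w (gamma n (q + m%:R))).
Proof.
move=> qn aq; elim: m => [|m IH]; first by rewrite addr0.
rewrite IH -natr1 addrA; apply: aspan_gammaD1; first exact: nonpoleD.
apply: algebraic_add aq _.
by rewrite -(rmorph_nat (ratr : {rmorphism rat -> R})); exact: algebraic_id.
Qed.

(** If all the derivatives lay in the span of a finite family w, the coefficients
    of the reflection formula, which are quadratic in them, would lie in the span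
    of the products of two members of w.  These coefficients are rational
    multiples of powers of pi, nonzero for infinitely many exponents; so pi
    would be algebraic. *)
Lemma base_not_aspan (e : bool) (I : finType) (w : I -> R) :
  ~ forall n, aspan w (gamma n (base R e)).
Proof.
move=> wb; have b0 : 0 < base R e by rewrite /base; case: e {wb}; lra.
have gE n : gamma n (base R e) = gjet n (base R e).
  exact: (gamma_jetE n gamma_jet_gt0).
have [r [rE rr]] := refl_coeff_rational e R.
have arat (x : rat) : algebraic (ratr x) by exact: (algebraic_id (ratr : {rmorphism rat -> R})).
have anat n : algebraic n%:R.
  by rewrite -(rmorph_nat (ratr : {rmorphism rat -> R})); exact: arat.
apply: (@pi_transcendental R).
apply: (@aspan_powers_algebraic _ _ (fun p : I * I => w p.1 * w p.2)) => M.
have [n Mn rn] := rational_reciprocal_neq0 rr M.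
exists (n + e)%N; first by rewrite (leq_trans Mn) ?leq_addr.
have -> : pi ^+ (n + e) = (ratr (r n))^-1 * refl_coeff R e n :> R.
  by rewrite rE mulrC mulfK // fmorph_eq0.
apply: aspanZ; first exact: algebraic_inv.
apply: aspan_sum => k; apply: aspanZ => //; apply: aspanM; first by rewrite -gE.
apply: aspanZ; last by rewrite -gE.
have -> : (-1) ^+ (n - k) = ratr ((-1) ^+ (n - k)) :> R by rewrite rmorphXn rmorphN1.
exact: arat.
Qed.

End GammaJets.

(** * Half-integers and the conclusion *)

Lemma half_integer_base (R : realType) (q : R) (k : int) : q = k%:~R / 2 -> nonpole q ->
  exists (e : bool) (m : nat), q = base R e + m%:R \/ base R e = q + m%:R.
Proof.
have half n : n%:R = (n./2)%:R * 2 + (odd n)%:R :> R.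
  by rewrite -natrM -natrD muln2 addnC odd_double_half.
case: k => n qE qn.
- have E : q = n%:R / 2 by rewrite qE.
  case on : (odd n); move: E; rewrite half on /= => E.
    by exists true, n./2; left; rewrite E /base /=; field.
  case nh : n./2 E => [|m] E.
    by have := nonpole_neq0 qn; rewrite E mul0r addr0 mul0r eqxx.
  by exists false, m; left; rewrite E /base -natr1 /=; field.
- have E : q = - (n.+1%:R / 2) by rewrite qE NegzE mulrNz mulNr.
  case on : (odd n.+1); move: E; rewrite half on => E.
    by exists true, n.+1./2.+1; right; rewrite E /base -natr1 /=; field.
  have := qn n.+1./2; rewrite E addr0 mulfK ?eqxx //.
Qed.

Theorem theorem1 (R : realType) (q : R)
    (q_half : exists k : int, q = k%:~R / 2)
    (q_nonpole : ~ exists m : nat, q = - m%:R) :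
  infinite_set [set n : nat |
    (1 <= n)%N /\ ~ algebraicOver (ratr : rat -> R) (derive1n n (@Gamma R) q)].
Proof.
move=> /finite_seqP[s sE].
have qn : nonpole q by move=> m; apply/eqP => E; apply: q_nonpole; exists m.
have [k qE] := q_half.
have aq : algebraicOver (ratr : rat -> R) q.
  rewrite qE -(ratr_int R) -(rmorph_nat (ratr : {rmorphism rat -> R})) -fmorph_div.
  exact: algebraic_id.
pose N := (\max_(i <- s) i).+1.
have algN n : (N <= n)%N -> algebraicOver (ratr : rat -> R) (derive1n n (@Gamma R) q).
  move=> Nn; apply: contrapT => na.
  have : n \in s.
    have : [set` s] n by rewrite -sE; split=> //; exact: leq_trans Nn.
    by [].
  by move=> ns; move: Nn; rewrite /N ltnNge (@leq_bigmax_seq _ _ predT id).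
(* The first N derivatives, and 1, whose algebraic multiples account for all the
   derivatives of order at least N. *)
pose w (o : option 'I_N) := if o is Some i then derive1n i (@Gamma R) q else 1.
have wq n : aspan w (derive1n n (@Gamma R) q).
  have [nN|Nn] := ltnP n N.
    exists (fun o => (o == Some (Ordinal nN))%:R); rewrite (bigD1 (Some (Ordinal nN))) //=.
    rewrite eqxx big1 ?addr0 => [|o /negPf->]; last exact: mul0r.
    by rewrite [RHS]mul1r.
  have /algebraic_predP an := algN _ Nn.
  exists (fun o => if o is None then AlgReal an else 0); rewrite (bigD1 None) //=.
  rewrite mulr1 big1 ?addr0 // => -[ o |] // _; exact: mul0r.
have [e [m [E|E]]] := half_integer_base qE qn.
- have an : algebraicOver (ratr : rat -> R) (base R e).
    rewrite -[base R e](addrK m%:R) -E; apply: algebraic_sub => //.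
    by rewrite -(rmorph_nat (ratr : {rmorphism rat -> R})); exact: algebraic_id.
  have bn : nonpole (base R e).
    move=> j; rewrite -subr_eq0 opprK lt0r_neq0 // ltr_pwDl // /base.
    by case: (e); rewrite ?invr_gt0.
  apply: (@base_not_aspan R e _ w).
  by apply/(aspan_gammaDn w m bn an); rewrite -E.
- apply: (@base_not_aspan R e _ w).
  by rewrite E; apply/(aspan_gammaDn w m qn aq).
Qed.
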